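(* Suppose that $\int \phi(\|x\|)\,P(dx)<\infty$ and that $m_j(P)>m_k(P)$ for $j=1,2,\dots,k-1$. Then $\Theta'\neq\emptyset$, $$\lim_{n\to\infty} d(\hat\theta_n,\Theta')=0\quad\text{a.s.},\qquad\text{and}\qquad \lim_{n\to\infty} m_k(P_n)=m_k(P)\quad\text{a.s.}$$
   Context: Let $p,q,k$ be positive integers with $q\le p$. Let $X_1,X_2,\dots$ be i.i.d. random vectors in $\mathbb{R}^p$, defined on a probability space $(\Omega,\mathcal F,\mathbb P)$, with common distribution $P$, and let $P_n$ be the empirical measure of $X_1,\dots,X_n$. $\|\cdot\|$ is the Euclidean norm and $\|\cdot\|_F$ the Frobenius norm. $\phi:\mathbb R\to\mathbb R$ is a non-negative, nondecreasing, continuous function with $\phi(0)=0$, and there is $\lambda>0$ with $\phi(2r)\le\lambda\phi(r)$ for all $r>0$. $\mathcal O(p\times q)$ is the set of real $p\times q$ matrices $A$ with $A^TA=I_q$. For $j\ge1$, $\mathcal R_j$ is the set of nonempty subsets of $\mathbb R^q$ with at most $j$ elements, and $\Xi_j=\mathcal R_j\times\mathcal O(p\times q)$. For a probability measure $Q$ on $\mathbb R^p$, a nonempty finite set $F\subset\mathbb R^q$ and $A\in\mathcal O(p\times q)$, $$\Phi(F,A,Q)=\int\min_{f\in F}\phi(\|x-Af\|)\,Q(dx),\qquad m_j(Q)=\inf_{(F,A)\in\Xi_j}\Phi(F,A,Q).$$ For $\theta=(F,A)$ write $\Phi(\theta,Q)=\Phi(F,A,Q)$. Put $\Theta'=\{\theta\in\Xi_k:\Phi(\theta,P)=m_k(P)\}$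 and $\Theta'_n=\{\theta\in\Xi_k:\Phi(\theta,P_n)=m_k(P_n)\}$. The estimator $\hat\theta_n$ is a measurable selection from $\Theta'_n$. For nonempty finite $F,G\subset\mathbb R^q$, $d_H(F,G)=\max\{\max_{f\in F}\min_{g\in G}\|f-g\|,\ \max_{g\in G}\min_{f\in F}\|f-g\|\}$ is the Hausdorff distance. The product distance is $d((F,A),(G,B))=d_H(F,G)+\|A-B\|_F$, and $d(\theta,\Theta')=\inf_{\theta'\in\Theta'}d(\theta,\theta')$. *)

(* Defs.v *)
From HB Require Import structures.
From mathcomp Require Import all_boot all_order all_algebra finmap.
From mathcomp Require Import all_classical all_reals all_analysis.

Set Implicit Arguments.
Unset Strict Implicit.
Unset Printing Implicit Defensive.

Import Order.TTheory GRing.Theory Num.Theory.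
Import numFieldNormedType.Exports.

Local Open Scope classical_set_scope.
Local Open Scope ring_scope.

(* Borel sigma-algebra of R^p. *)
Notation borelcV R p := (g_sigma_algebraType (@open 'cV[R]_p)).

(* The library norm on matrices is the max norm. This one is the Frobenius
   norm, i.e. the Euclidean norm when A is a column vector. *)
Definition norm2 (R : realType) (m n : nat) (A : 'M[R]_(m, n)) : R :=
  Num.sqrt (\sum_i \sum_j A i j ^+ 2).

Definition mutually_independent (R : realType) (d d' : measure_display)
    (Omega : measurableType d) (T : measurableType d') (Pr : probability Omega R)
    (X : nat -> {RV Pr >-> T}) : Prop :=
  forall (J : {fset nat}) (B : nat -> set T), (forall i, measurable (B i)) ->
    Pr (\bigcap_(i in [set` J]) (X i @^-1` B i)) =
    \big[*%E/1%E]_(i <- J) Pr (X i @^-1` B i).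

(* The sample of size n consists of X 0, ..., X n.-1. For n = 0 this is the
   zero measure rather than a probability. *)
Definition empirical (R : realType) (d d' : measure_display)
    (Omega : measurableType d) (T : measurableType d') (Pr : probability Omega R)
    (X : nat -> {RV Pr >-> T}) (n : nat) (w : Omega) :
    {measure set T -> \bar R} :=
  mscale (n%:R^-1)%:nng (msum (fun i => \d_(X i w)) n).

Definition param (R : realType) (p q : nat) : Type :=
  ({fset 'cV[R]_q} * 'M[R]_(p, q))%type.
HB.instance Definition _ (R : realType) (p q : nat) := Choice.on (param R p q).
(* Only needed to make [borel_param] a measurableType. *)
HB.instance Definition _ (R : realType) (p q : nat) :=
  isPointed.Build (param R p q) (fset0, 0).

Definition Xi {R : realType} {p q : nat} (j : nat) : set (param R p q) :=
  [set th | [/\ th.1 != fset0, (#|` th.1 | <= j)%N & th.2^T *m th.2 = 1%:M]].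

(* The extended reals supply neutral elements for min and max; they are never
   reached on nonempty finite sets, so the operations below are the usual real
   minima and maxima on Xi j. *)
Definition Phi (R : realType) (p q : nat) (phi : R -> R) (th : param R p q)
    (Q : {measure set (borelcV R p) -> \bar R}) : \bar R :=
  (\int[Q]_x \big[mine/+oo]_(f <- th.1)
     (phi (norm2 ((x : 'cV[R]_p) - th.2 *m f)))%:E)%E.

Definition minrisk {R : realType} {p : nat} (q : nat) (phi : R -> R) (j : nat)
    (Q : {measure set (borelcV R p) -> \bar R}) : \bar R :=
  ereal_inf [set Phi phi th Q | th in @Xi R p q j].

Definition minimizers {R : realType} {p : nat} (q : nat) (phi : R -> R) (k : nat)
    (Q : {measure set (borelcV R p) -> \bar R}) : set (param R p q) :=
  [set th | Xi k th /\ Phi phi th Q = minrisk q phi k Q].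
Arguments minimizers {R p} q phi k Q _.

Definition hausdorff (R : realType) (q : nat) (F G : {fset 'cV[R]_q}) : \bar R :=
  let excess (F' G' : {fset 'cV[R]_q}) := \big[maxe/-oo%E]_(f <- F')
     \big[mine/+oo%E]_(g <- G') (norm2 (f - g))%:E in
  maxe (excess F G) (excess G F).

Definition pdist (R : realType) (p q : nat) (th th' : param R p q) : \bar R :=
  (hausdorff th.1 th'.1 + (norm2 (th.2 - th'.2))%:E)%E.

Definition pdist_set (R : realType) (p q : nat) (th : param R p q)
    (S : set (param R p q)) : \bar R :=
  ereal_inf [set pdist th th' | th' in S].

Definition open_param (R : realType) (p q k : nat) : set (set (param R p q)) :=
  [set U | U `<=` Xi k /\ forall th, U th -> exists2 e : R, 0 < e &
     forall th', Xi k th' -> (pdist th th' < e%:E)%E -> U th'].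

(* Sigma-algebra generated on the whole type by the open sets of the metric
   space (Xi k, pdist); its trace on Xi k is the Borel sigma-algebra. *)
Notation borel_param R p q k := (g_sigma_algebraType (@open_param R p q k)).

Definition measurable_selection (R : realType) (d : measure_display)
    (Omega : measurableType d) (p q k : nat) (t : Omega -> param R p q)
    (S : Omega -> set (param R p q)) : Prop :=
  measurable_fun [set: Omega] (t : Omega -> borel_param R p q k) /\
  forall w, S w (t w).

(* Main.v *)
Require Import Defs.
From mathcomp Require Import all_boot all_order all_algebra finmap.
From mathcomp Require Import all_classical all_reals all_analysis.
From mathcomp Require Import measurable_realfun ring lra.
Import Order.TTheory GRing.Theory Num.Theory.
Import numFieldNormedType.Exports.
Local Open Scope classical_set_scope.
Local Open Scope ring_scope.

(* The map (F, A) -> min_f phi(|x - A f|) is treated on a compactification in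
   which centres may escape to infinity.  Along an ultrafilter of indices, the
   matrices A_n converge and every centre either converges or escapes; an
   escaping centre contributes sup phi, so in the limit it can be dropped.  The
   "surrogate" functions, indexed by rational vectors and an integer r, bound
   the integrand from below near such a limit and recover it as r grows; they
   are bounded and countably many, so the strong law applies to all of them
   simultaneously, and Fatou's lemma gives Phi(limit, P) <= liminf of the risks.
   Since m_j(P) > m_k(P) for j < k, a limit with risk at most m_k(P) keeps all k
   centres and is a minimizer; applied to P itself this yields existence.  All
   centres cannot escape because m_k(P) < sup phi: a small ball of positive
   P-mass can be centred at some A f by a Householder reflection.

   The strong law is proved by truncation: deviations of bounded functions are
   controlled along the squares, and tails by dyadic blocks as in Etemadi's
   proof. *)

(** * The strong law of large numbers *)

Section series_bounds.
Context {R : realType}.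

Lemma nneseries_lty (u : nat -> \bar R) (c : R) : (forall n, 0 <= u n)%E ->
  (forall n, \sum_(0 <= j < n) u j <= c%:E)%E ->
  (\sum_(0 <= j <oo) u j < +oo)%E.
Proof.
move=> u0 uc; apply: (@le_lt_trans _ _ c%:E); last exact: ltry.
apply: lime_le; first exact: is_cvg_nneseries.
exact: nearW.
Qed.

Lemma sum_inv_sq_le (n : nat) :
  \sum_(0 <= j < n) (j.+1%:R ^+ 2)^-1 <= 2 :> R.
Proof.
suff H m : \sum_(0 <= j < m.+1) (j.+1%:R ^+ 2)^-1 <= 2 - m.+1%:R^-1 :> R.
  case: n => [|n]; first by rewrite big_nil.
  by rewrite (le_trans (H n))// gerBl.
elim: m => [|m IH]; first by rewrite big_nat1 expr1n invr1; lra.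
rewrite big_nat_recr//= (le_trans (lerD IH (lexx _)))//.
rewrite -subr_ge0 (_ : _ - _ = (m.+1%:R * m.+2%:R ^+ 2)^-1).
  by rewrite invr_ge0 mulr_ge0.
have m1 : m.+1%:R != 0 :> R by rewrite pnatr_eq0.
have m2 : m.+1%:R + 1 != 0 :> R by rewrite natr1 pnatr_eq0.
by rewrite -[m.+2%:R]natr1; move: (m.+1%:R) m1 m2 => x x0 x1; field; rewrite x0 x1.
Qed.

Lemma sum_dyadic_tail_le (y : R) (n : nat) : 0 <= y ->
  \sum_(0 <= j < n) 2 ^+ j * (2 ^+ j < y)%R%:R <= Num.min (2 * y) (2 ^+ n).
Proof.
move=> y0; elim: n => [|n]; first by rewrite big_nil le_min mulr_ge0//= ler01.
rewrite !le_min big_nat_recr//= exprS => /andP[IH1 IH2].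
have n0 : 0 < 2 ^+ n :> R by rewrite exprn_gt0.
by case: (ltP (2 ^+ n) y) => yn; rewrite ?mulr1 ?mulr0; apply/andP; split; lra.
Qed.

Lemma sum_dyadic_head_le (y : R) (n : nat) : 0 <= y ->
  \sum_(0 <= j < n) (2 ^+ j)^-1 * (y ^+ 2 * (y <= 2 ^+ j)%R%:R) <=
  Num.max 0 (2 * y - 2 * (y ^+ 2 / 2 ^+ n)).
Proof.
move=> y0; elim: n => [|n IH]; first by rewrite big_nil le_max lexx.
rewrite big_nat_recr//= (le_trans (lerD IH (lexx _)))// [2 ^+ n.+1]exprS invfM.
have n0 : 0 < (2 ^+ n : R) by rewrite exprn_gt0.
case: (leP y (2 ^+ n)) => yn; rewrite ?mulr1 ?mulr0 ?addr0.
  rewrite max_r; last first.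
    by rewrite subr_ge0 ler_pM2l// ler_pdivrMr// expr2 ler_wpM2l.
  by rewrite le_max; apply/orP; right; lra.
rewrite max_l ?le_max ?lexx// subr_le0 ler_pM2l// ler_pdivlMr// expr2.
by rewrite ler_wpM2l// ltW.
Qed.
End series_bounds.

Lemma borel_cantelli {R : realType} {d} {T : measurableType d}
    (mu : {measure set T -> \bar R}) (F : nat -> set T) :
  (forall n, measurable (F n)) -> (\sum_(0 <= n <oo) mu (F n) < +oo)%E ->
  {ae mu, forall x, \forall n \near \oo, ~ F n x}.
Proof.
move=> mF F_sum; exists (lim_sup_set F); split.
- apply: bigcap_measurable => // n _.
  by apply: bigcup_measurable => k _; exact: mF.
- exact: lim_sup_set_cvg0.
- move=> x /=; apply: contra_notP => /existsNP[n nF]; exists n => // k /= nk Fk.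
  by apply: nF => _; exists k.
Qed.

Section interpolation.
Context {R : realType}.

Lemma exists_invr_lt (e : R) : 0 < e -> exists m : nat, m.+1%:R^-1 < e.
Proof.
move=> e0; exists (Num.truncn e^-1).
by rewrite invf_plt ?posrE// truncnS_gt.
Qed.

Lemma nat_sqrt_exists (n : nat) : (0 < n)%N ->
  exists2 j, (j.+1 ^ 2 <= n)%N & (n < j.+2 ^ 2)%N.
Proof.
elim: n => // -[|n] IH _; first by exists 0%N.
have [j j1 j2] := IH isT.
have [nj|nj] := ltnP n.+2 (j.+2 ^ 2); first by exists j => //; rewrite ltnW.
by exists j.+1 => //; rewrite (leq_ltn_trans j2)// ltn_exp2r.
Qed.

Lemma cvg_along_squares (S : nat -> R) (mu : R) :
  {homo S : m n / (m <= n)%N >-> m <= n} ->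
  0 <= mu ->
  (forall m : nat, \forall j \near \oo,
    `|S (j.+1 ^ 2)%N - (j.+1 ^ 2)%:R * mu| < (j.+1 ^ 2)%:R * m.+1%:R^-1) ->
  forall e, 0 < e -> \forall n \near \oo, `|S n - n%:R * mu| <= n%:R * e.
Proof.
move=> S_nd mu0 S_sq e e0.
have [m me] := exists_invr_lt _ (divr_gt0 e0 (ltr0Sn R 4)).
set dl := m.+1%:R^-1 in me.
have dl0 : 0 < dl by rewrite invr_gt0.
have [J _ SJ] := S_sq m.
pose K := (Num.truncn (3 * mu / dl)).+1.
exists ((J + K).+2 ^ 2)%N => // n /= nJK.
have n0 : (0 < n)%N by rewrite (leq_trans _ nJK)// expn_gt0.
have [j j1 j2] := nat_sqrt_exists _ n0.
have jJK : (J + K <= j)%N.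
  by have := leq_ltn_trans nJK j2; rewrite ltn_exp2r// !ltnS => /ltnW.
have jJ : (J <= j)%N by rewrite (leq_trans _ jJK)// leq_addr.
have := SJ j jJ; have := SJ j.+1 (leqW jJ).
have := S_nd _ _ j1; have := S_nd _ _ (ltnW j2).
have : (j.+1 ^ 2)%:R <= n%:R :> R by rewrite ler_nat.
have : n%:R <= (j.+2 ^ 2)%:R :> R by rewrite ler_nat ltnW.
have x1 : 1 <= j.+1%:R :> R by rewrite ler1n.
have xK : 3 * mu <= dl * j.+1%:R.
  rewrite [leRHS]mulrC -ler_pdivrMr//.
  apply: (le_trans (ltW (truncnS_gt _))); rewrite ler_nat.
  by rewrite (leq_trans _ (leqW jJK))// leq_addl.
rewrite !natrX -[j.+2%:R]natr1 -/dl.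
move: (S _) (S (j.+1 ^ 2)%N) (S n) (n%:R) (j.+1%:R) x1 xK => s2 s1 s nn x x1 xK.
rewrite ltr_norml ler_norml => n2 n1 ss2 s1s /andP[B1 B2].
rewrite ltr_norml => /andP[A1 A2].
have H1 : 3 * mu * x <= dl * x * x by rewrite ler_wpM2r//; lra.
have H2 : x * mu <= x * x * mu by rewrite ler_wpM2r// ler_peMl//; lra.
have H3 : mu <= x * mu by rewrite ler_peMl.
have H4 : dl * x <= dl * x * x by rewrite ler_peMr// mulr_ge0//; lra.
have H5 : dl <= dl * x by rewrite ler_peMr// ltW.
have H6 : x ^+ 2 * mu <= nn * mu by rewrite ler_wpM2r.
have H7 : nn * mu <= (x + 1) ^+ 2 * mu by rewrite ler_wpM2r.
have H8 : x ^+ 2 * dl <= nn * dl by rewrite ler_wpM2r// ltW.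
have nn0 : 0 <= nn by rewrite (le_trans _ n1)// sqr_ge0.
have H9 : nn * dl * 5 <= nn * e.
  by rewrite -mulrA ler_wpM2l// -ler_pdivlMr// ltW.
apply/andP; split; lra.
Qed.

Lemma bounded_along_dyadic (S : nat -> R) (b : R) :
  {homo S : m n / (m <= n)%N >-> m <= n} -> 0 <= b ->
  (\forall j \near \oo, S (2 ^ j)%N <= (2 ^ j)%:R * b) ->
  \forall n \near \oo, S n <= n%:R * (2 * b).
Proof.
move=> S_nd b0 [J _ SJ]; exists (2 ^ J)%N => // n /= Jn.
have n0 : (0 < n)%N by rewrite (leq_trans _ Jn)// expn_gt0.
have /andP[k1 k2] := trunc_log_bounds (isT : (1 < 2)%N) n0.
set k := trunc_log 2 n in k1 k2.
have Jk : (J <= k.+1)%N.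
  by rewrite ltnW// -(ltn_exp2l _ _ (isT : (1 < 2)%N)) (leq_ltn_trans Jn).
apply: (le_trans (S_nd _ _ (ltnW k2))); apply: (le_trans (SJ _ Jk)).
by rewrite expnS mulnC natrM -mulrA ler_wpM2r ?ler_nat// mulr_ge0.
Qed.
End interpolation.

Section probability_integral.
Context {R : realType} {d : measure_display} {T : measurableType d}.

Lemma bounded_integrable (mu : probability T R) (f : T -> R) (M : R) :
  measurable_fun setT f -> (forall x, `|f x| <= M) ->
  mu.-integrable setT (EFin \o f).
Proof.
move=> mf fM; apply: measurable_bounded_integrable => //.
  by rewrite -ge0_fin_numE ?fin_num_measure.
exists M; split; first exact: num_real.
by move=> y My x _ /=; rewrite (le_trans (fM x))// ltW.
Qed.

Lemma integral_prob_cst (mu : probability T R) (c : R) :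
  (\int[mu]_x c%:E = c%:E)%E.
Proof. by rewrite integral_cst//= probability_setT mule1. Qed.
End probability_integral.

Section iid.
Context {R : realType} {d d' : measure_display} {Omega : measurableType d}
  {T : measurableType d'} {Pr : probability Omega R} {P : probability T R}
  {X : nat -> {RV Pr >-> T}}.
Context (X_law : forall i B, measurable B -> Pr (X i @^-1` B) = P B).
Context (X_pair : forall i j A B, i != j -> measurable A -> measurable B ->
  Pr (X i @^-1` A `&` X j @^-1` B) = (P A * P B)%E).

Lemma integral_law (i : nat) (f : T -> \bar R) : measurable_fun setT f ->
  (forall x, 0 <= f x)%E ->
  (\int[Pr]_w f (X i w) = \int[P]_x f x)%E.
Proof.
move=> mf f0; rewrite -[LHS](ge0_integral_distribution (X i))//.
by apply: eq_measure_integral => A mA _; exact: X_law.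
Qed.

Lemma integral_pair_eq0 (i j : nat) (u : T -> R) (M : R) : i != j ->
  measurable_fun setT u -> (forall x, `|u x| <= M) ->
  (\int[P]_x (u x)%:E = 0)%E ->
  (\int[Pr]_w (u (X i w) * u (X j w))%:E = 0)%E.
Proof.
move=> ij mu uM u0.
pose XX w := (X i w, X j w).
have mXX : measurable_fun setT XX by apply/measurable_fun_pair.
pose f (z : T * T) := u z.1 * u z.2.
have mf : measurable_fun setT f.
  by apply: measurable_funM; apply: measurableT_comp.
have fM z : `|f z| <= M * M by rewrite normrM ler_pM.
pose D := distribution Pr (mfun_Sub (mem_set mXX)).
transitivity (\int[D]_z (f z)%:E)%E.
  rewrite integral_distribution//; first exact/measurable_EFinP.
  apply: (@bounded_integrable _ _ _ Pr (f \o XX) (M * M)).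
    exact: measurableT_comp.
  by move=> w; exact: fM.
transitivity (\int[(P \x P)%E]_z (f z)%:E)%E.
  apply/esym/eq_measure_integral => A mA _.
  apply: product_measure_unique => // B C mB mC.
  by rewrite -(X_pair _ _ _ _ ij).
rewrite -integral12_prod_meas1; last first.
  exact: (@bounded_integrable _ _ _ (P \x P)%E f (M * M)).
rewrite (eq_integral (cst 0%E)) ?integral0// => x _.
rewrite /fubini_F /f/=; under eq_integral do rewrite EFinM.
rewrite integralZl ?u0 ?mule0//.
exact: (bounded_integrable _ _ M).
Qed.

Lemma integral_sq_sum (u : T -> R) (M : R) (N : nat) :
  measurable_fun setT u -> (forall x, `|u x| <= M) ->
  (\int[P]_x (u x)%:E = 0)%E ->
  (\int[Pr]_w ((\sum_(i < N) u (X i w)) ^+ 2)%:E =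
   N%:R%:E * \int[P]_x (u x ^+ 2)%:E)%E.
Proof.
move=> mu uM u0.
have mXu i : measurable_fun setT (fun w => u (X i w)) by exact: measurableT_comp.
have intu (i j : nat) :
    Pr.-integrable setT (fun w => (u (X i w) * u (X j w))%:E).
  apply: (@bounded_integrable _ _ _ Pr _ (M * M)).
    exact: measurable_funM.
  by move=> w; rewrite normrM ler_pM.
transitivity (\int[Pr]_w (\sum_(i < N) \sum_(j < N) (u (X i w) * u (X j w))%:E))%E.
  apply: eq_integral => w _; rewrite expr2 mulr_suml -sumEFin.
  by apply: eq_bigr => i _; rewrite mulr_sumr -sumEFin.
rewrite integral_sum//; last by move=> i; exact: integrable_sum.
under eq_bigr => i _.
  rewrite integral_sum// (bigD1 i)//= big1 ?adde0; last first.
    move=> j ji; apply: (@integral_pair_eq0 i j u M) => //.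
    by rewrite eq_sym.
  rewrite (integral_law i (fun x => (u x * u x)%:E)); first last.
  - by move=> x; rewrite lee_fin -expr2 sqr_ge0.
  - by apply/measurable_EFinP; exact: measurable_funM.
  over.
by rewrite sumr_const card_ord mule_natl.
Qed.

Lemma deviation_le (g : T -> R) (M mu e : R) (N : nat) :
  measurable_fun setT g -> (forall x, `|g x| <= M) ->
  (\int[P]_x (g x)%:E = mu%:E)%E -> 0 < e -> (0 < N)%N ->
  (Pr [set w | (N%:R * e <= `|\sum_(i < N) g (X i w) - N%:R * mu|)%R] <=
   (N%:R * e ^+ 2)^-1%:E * \int[P]_x (g x ^+ 2)%:E)%E.
Proof.
move=> mg gM gmu e0 N0.
pose u x := g x - mu.
have mu' : measurable_fun setT u by exact: measurable_funB.
have intg : P.-integrable setT (EFin \o g) by exact: (bounded_integrable _ _ M).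
have intc c : P.-integrable setT (EFin \o cst c).
  exact: (bounded_integrable P (cst c) `|c|).
have u0 : (\int[P]_x (u x)%:E = 0)%E.
  under eq_integral do rewrite EFinB.
  rewrite integralB//; last exact: (intc mu).
  by rewrite gmu integral_prob_cst -EFinB subrr.
have uM x : `|u x| <= M + `|mu| by rewrite (le_trans (ler_normB _ _))// lerD2r.
have intg2 : P.-integrable setT (fun x => (g x ^+ 2)%:E).
  apply: (@bounded_integrable _ _ _ P _ (M ^+ 2)); first exact: measurable_funX.
  by move=> x; rewrite normrX lerXn2r// nnegrE (le_trans _ (gM x)).
have u2 : (\int[P]_x (u x ^+ 2)%:E <= \int[P]_x (g x ^+ 2)%:E)%E.
  have -> : (\int[P]_x (u x ^+ 2)%:E =
      \int[P]_x (g x ^+ 2)%:E + (- (mu ^+ 2))%:E)%E.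
    transitivity (\int[P]_x ((g x ^+ 2)%:E +
        ((- 2 * mu)%:E * (g x)%:E + (mu ^+ 2)%:E)))%E.
      by apply: eq_integral => x _; rewrite -!EFinM -!EFinD; congr EFin; rewrite /u; ring.
    rewrite integralD//; last first.
      by apply: integrableD => //; [exact: integrableZl|exact: intc].
    rewrite integralD//; [|exact: integrableZl|exact: intc].
    rewrite integralZl// gmu integral_prob_cst.
    by congr adde; rewrite -EFinM -EFinD; congr EFin; ring.
  by rewrite -[leRHS]adde0 leeD2l// lee_fin oppr_le0 sqr_ge0.
have mS : measurable_fun setT (fun w => (\sum_(i < N) u (X i w)) ^+ 2).
  apply: measurable_funX; apply: measurable_sum => i.
  exact: measurableT_comp.
have N0' : 0 < N%:R :> R by rewrite ltr0n.
have Ne0 : 0 < (N%:R * e) ^+ 2 by rewrite exprn_gt0// mulr_gt0.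
have := le_integral_abse Pr measurableT (iffRL (measurable_EFinP _ _) mS) Ne0.
rewrite setTI.
under eq_integral do rewrite gee0_abs ?lee_fin ?sqr_ge0//.
rewrite (integral_sq_sum _ (M + `|mu|))// => H.
have -> : [set w | N%:R * e <= `|\sum_(i < N) g (X i w) - N%:R * mu|] =
    [set x | (((N%:R * e) ^+ 2)%:E <=
      `|(EFin \o (fun w => ((\sum_(i < N) u (X i w)) ^+ 2)%R)) x|)%E].
  apply: eq_set => w /=; rewrite lee_fin normrX ler_sqr ?nnegrE ?(ltW (mulr_gt0 N0' e0))//.
  by rewrite /u big_split/= sumrN sumr_const card_ord [_ * mu]mulr_natl.
rewrite lee_pdivlMl; last by rewrite mulr_gt0// exprn_gt0.
rewrite -(@lee_pmul2l _ N%:R%:E)//.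
rewrite muleA -EFinM (_ : N%:R * (N%:R * e ^+ 2) = (N%:R * e) ^+ 2); last by ring.
by rewrite (le_trans H)// lee_wpmul2l// lee_fin ler0n.
Qed.

Lemma slln_bounded (g : T -> R) (M mu : R) :
  measurable_fun setT g -> (forall x, 0 <= g x <= M) ->
  (\int[P]_x (g x)%:E = mu%:E)%E ->
  {ae Pr, forall w, forall e, 0 < e -> \forall n \near \oo,
    `|\sum_(i < n) g (X i w) - n%:R * mu| <= n%:R * e}.
Proof.
move=> mg g0M gmu.
have gM x : `|g x| <= M by have /andP[g0 gM] := g0M x; rewrite ger0_norm.
have mgX i : measurable_fun setT (fun w => g (X i w)) by exact: measurableT_comp.
have mu0 : 0 <= mu.
  by rewrite -lee_fin -gmu integral_ge0// => x _; rewrite lee_fin; have /andP[] := g0M x.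
have g2M : (\int[P]_x (g x ^+ 2)%:E <= (M ^+ 2)%:E)%E.
  rewrite -(integral_prob_cst P); apply: ge0_le_integral => //.
  - by move=> x _; rewrite lee_fin sqr_ge0.
  - by apply/measurable_EFinP; exact: measurable_funX.
  - move=> x _; rewrite lee_fin; have /andP[? ?] := g0M x.
    by rewrite lerXn2r// nnegrE (le_trans _ (gM x)).
pose F (m j : nat) : set Omega := [set w | (j.+1 ^ 2)%:R * m.+1%:R^-1 <=
  `|\sum_(i < j.+1 ^ 2) g (X i w) - (j.+1 ^ 2)%:R * mu|].
have mF m j : measurable (F m j).
  rewrite -[F m j]setTI; apply: measurable_fun_le => //.
  apply: measurableT_comp => //; apply: measurable_funB => //.
  exact: measurable_sum.
suff F_sum m : (\sum_(0 <= j <oo) Pr (F m j) < +oo)%E.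
  have := ae_foralln (fun m => borel_cantelli Pr (F m) (mF m) (F_sum m)).
  apply: filterS => w Fw; apply: cvg_along_squares => //.
    move=> a b ab; rewrite -!(big_mkord xpredT (fun i => g (X i w))).
    rewrite [leRHS](big_cat_nat _ ab)//= lerDl sumr_ge0// => i _.
    by have /andP[] := g0M (X i w).
  move=> m; apply: filterS (Fw m) => j /negP.
  by rewrite -ltNge.
pose c := M ^+ 2 / (m.+1%:R^-1 ^+ 2).
have c0 : 0 <= c by rewrite divr_ge0 ?sqr_ge0.
apply: (@nneseries_lty _ _ (c * 2)) => // n.
apply: (@le_trans _ _ (\sum_(0 <= j < n) (c * (j.+1%:R ^+ 2)^-1)%:E)%E); last first.
  by rewrite sumEFin lee_fin -mulr_sumr ler_wpM2l// sum_inv_sq_le.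
apply: lee_sum => j _.
apply: (le_trans (deviation_le g M mu _ _ mg gM gmu _ _)) => //; rewrite ?expn_gt0//.
apply: (le_trans (lee_wpmul2l _ g2M)) => //; rewrite -EFinM lee_fin.
by rewrite /c natrX invfM mulrC mulrA mulrAC.
Qed.

Lemma slln_dominated (h : T -> R) (a e : R) :
  measurable_fun setT h -> (forall x, 0 <= h x) ->
  (\int[P]_x (h x)%:E <= a%:E)%E -> 0 < e ->
  {ae Pr, forall w, \forall n \near \oo,
    \sum_(i < n) h (X i w) <= n%:R * (2 * (a + e))}.
Proof.
move=> mh h0 ha e0.
have a0 : 0 <= a.
  by rewrite -lee_fin (le_trans _ ha)// integral_ge0// => x _; rewrite lee_fin.
pose A j := [set x | h x <= 2 ^+ j].
have mA j : measurable (A j).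
  by rewrite -[A j]setTI; exact: measurable_fun_le.
have inA j x : (x \in A j) = (h x <= 2 ^+ j) by apply/idP/idP; rewrite inE.
pose g j x := h x * \1_(A j) x.
have mg j : measurable_fun setT (g j).
  by apply: measurable_funM => //; exact: measurable_indic.
have g0 j x : 0 <= g j x by rewrite mulr_ge0.
have gM j x : `|g j x| <= 2 ^+ j.
  rewrite ger0_norm// /g indicE inA; case: (leP (h x) (2 ^+ j)) => ?; rewrite ?mulr1// mulr0.
  by rewrite exprn_ge0.
have gh j x : g j x <= h x.
  by rewrite /g indicE inA; case: (leP (h x) (2 ^+ j)); rewrite ?mulr1 ?mulr0.
have [mu gmu] : exists mu : nat -> R, forall j, (\int[P]_x (g j x)%:E = (mu j)%:E)%E.
  exists (fun j => fine (\int[P]_x (g j x)%:E)%E) => j; rewrite fineK//.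
  by apply: integrable_fin_num => //; exact: (bounded_integrable _ _ (2 ^+ j)).
have mua j : mu j <= a.
  rewrite -lee_fin -gmu (le_trans _ ha)//; apply: ge0_le_integral => //.
  - by move=> x _; rewrite lee_fin.
  - exact/measurable_EFinP.
  - exact/measurable_EFinP.
  - by move=> x _; rewrite lee_fin.
have mhX i : measurable_fun setT (fun w => h (X i w)) by exact: measurableT_comp.
have mgX j i : measurable_fun setT (fun w => g j (X i w)) by exact: measurableT_comp.
pose F j : set Omega := [set w | (2 ^ j)%:R * (a + e) < \sum_(i < 2 ^ j) h (X i w)].
have mF j : measurable (F j).
  rewrite (_ : F j = ~` (setT `&` [set w | \sum_(i < 2 ^ j) h (X i w) <=
      (2 ^ j)%:R * (a + e)])); last first.
    by rewrite setTI; apply/seteqP; split=> w; rewrite /F/= ltNge => /negP.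
  apply: measurableC; apply: measurable_fun_le => //.
  exact: measurable_sum.
pose c := (e ^+ 2)^-1.
have c0 : 0 < c by rewrite invr_gt0 exprn_gt0.
(* [psi j] integrates to a bound for the probability of [F j]: a union bound
   for the event that some [h (X i)] exceeds [2 ^+ j], and Chebyshev's inequality
   for the truncated sum.  Summed over [j], it is at most a multiple of [h]. *)
pose psi j x := 2 ^+ j * (2 ^+ j < h x)%R%:R +
  c * ((2 ^+ j)^-1 * (h x ^+ 2 * (h x <= 2 ^+ j)%R%:R)).
have psiE j : psi j = fun x => 2 ^+ j * \1_(~` A j) x +
    c * ((2 ^+ j)^-1 * g j x ^+ 2).
  apply/funext => x; rewrite /psi /g !indicE in_setC inA -ltNge.
  by case: (leP (h x) (2 ^+ j)) => _; rewrite !(mulr1, mulr0, expr0n).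
have mpsi j : measurable_fun setT (psi j).
  rewrite psiE; apply: measurable_funD; apply: measurable_funM => //.
    by apply: measurable_indic; exact: measurableC.
  by apply: measurable_funM => //; exact: measurable_funX.
have psi0 j x : 0 <= psi j x.
  have p0 : 0 <= 2 ^+ j :> R by rewrite exprn_ge0.
  have q0 : 0 <= h x ^+ 2 * (h x <= 2 ^+ j)%R%:R by rewrite mulr_ge0// sqr_ge0.
  apply: addr_ge0; first exact: mulr_ge0.
  by apply: mulr_ge0; [exact: ltW|rewrite mulr_ge0// invr_ge0].
have FP j : (Pr (F j) <= \int[P]_x (psi j x)%:E)%E.
  pose G := \big[setU/set0]_(i < 2 ^ j) (X i @^-1` (~` A j)).
  pose D := [set w | (2 ^ j)%:R * e <= `|\sum_(i < 2 ^ j) g j (X i w) - (2 ^ j)%:R * mu j|].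
  have mXA i : measurable (X i @^-1` (~` A j)).
    rewrite -[X in measurable X]setTI; apply: measurable_funPT => //.
    exact: measurableC.
  have mG : measurable G by apply: bigsetU_measurable => i _; exact: mXA.
  have mD : measurable D.
    rewrite -[D]setTI; apply: measurable_fun_le => //.
    apply: measurableT_comp => //; apply: measurable_funB => //.
    exact: measurable_sum.
  have FGD : F j `<=` G `|` D.
    move=> w Fw; have [Gw|nGw] := pselect (G w); [by left|right].
    have E : \sum_(i < 2 ^ j) g j (X i w) = \sum_(i < 2 ^ j) h (X i w).
      apply: eq_bigr => i _; rewrite /g indicE (_ : _ \in _) ?mulr1//.
      rewrite inE; apply: contrapT => nA; apply: nGw.
      by rewrite /G -(bigcup_mkord _ (fun i => X i @^-1` (~` A j))); exists i => /=.
    rewrite /D /= E (le_trans _ (ler_norm _))// lerBrDr -mulrDr.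
    rewrite (le_trans _ (ltW Fw))// ler_wpM2l// addrC lerD2r//.
  apply: (@le_trans _ _ (Pr (G `|` D))).
    by apply: le_measure => //; rewrite inE//; exact: measurableU.
  apply: (le_trans (measureU2 _ _ _)) => //.
  rewrite psiE; under eq_integral do rewrite EFinD.
  have m1 : measurable_fun setT (fun x => 2 ^+ j * \1_(~` A j) x : R).
    by apply: measurable_funM => //; apply: measurable_indic; exact: measurableC.
  have m2 : measurable_fun setT (fun x => g j x ^+ 2) by exact: measurable_funX.
  rewrite ge0_integralD//; first last.
  - by apply/measurable_EFinP; do 2 apply: measurable_funM => //.
  - move=> x _; rewrite lee_fin; apply: mulr_ge0; first exact: ltW.
    by apply: mulr_ge0; rewrite ?sqr_ge0// invr_ge0 exprn_ge0.
  - exact/measurable_EFinP.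
  apply: leeD.
    under eq_integral do rewrite EFinM.
    rewrite ge0_integralZl_EFin//; last first.
    - by apply/measurable_EFinP; apply: measurable_indic; exact: measurableC.
    rewrite integral_indic ?setIT//; last exact: measurableC.
    apply: (le_trans (Boole_inequality Pr (fun i _ => mXA i))).
    rewrite (eq_bigr (fun=> P (~` A j))); last first.
      by move=> i _; apply: X_law; exact: measurableC.
    by rewrite sumr_const card_ord -natrX mule_natl.
  have N0 : (0 < 2 ^ j)%N by rewrite expn_gt0.
  apply: (le_trans (deviation_le _ _ _ _ _ (mg j) (gM j) (gmu j) e0 N0)).
  rewrite -ge0_integralZl_EFin//; first last.
  - by rewrite invr_ge0 mulr_ge0 ?sqr_ge0.
  - exact/measurable_EFinP.
  - by move=> x _; rewrite lee_fin sqr_ge0.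
  rewrite le_eqVlt; apply/orP; left; apply/eqP; apply: eq_integral => x _.
  by rewrite -EFinM natrX invfM (mulrC _ (e ^+ 2)^-1) -mulrA.
suff F_sum : (\sum_(0 <= j <oo) Pr (F j) < +oo)%E.
  have := borel_cantelli Pr F mF F_sum; apply: filterS => w Fw.
  apply: bounded_along_dyadic; last 2 first.
  - by rewrite addr_ge0// ltW.
  - by apply: filterS Fw => j /negP; rewrite -leNgt.
  move=> m n mn; rewrite -!(big_mkord xpredT (fun i => h (X i w))).
  by rewrite [leRHS](big_cat_nat _ mn)//= lerDl sumr_ge0.
apply: (@nneseries_lty _ _ ((2 + c * 2) * a)) => // n.
apply: (@le_trans _ _ (\sum_(0 <= j < n) \int[P]_x (psi j x)%:E)%E).
  by apply: lee_sum => j _; exact: FP.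
rewrite -ge0_integral_sum//=; first last.
- by move=> j x _; rewrite lee_fin.
- by move=> j; exact/measurable_EFinP.
apply: (@le_trans _ _ (\int[P]_x ((2 + c * 2)%:E * (h x)%:E))%E).
  apply: ge0_le_integral => //.
  - by move=> x _; apply: sume_ge0 => j _; rewrite lee_fin.
  - by apply: emeasurable_sum => j; exact/measurable_EFinP.
  - by apply/measurable_EFinP; exact: measurable_funM.
  move=> x _; rewrite sumEFin -EFinM lee_fin /psi big_split/= mulrDl lerD//.
    by rewrite (le_trans (sum_dyadic_tail_le _ _ (h0 x)))// ge_min lexx.
  rewrite -mulr_sumr -[c * 2 * _]mulrA; apply: ler_wpM2l; first exact: ltW.
  apply: (le_trans (sum_dyadic_head_le _ _ (h0 x))); rewrite ge_max mulr_ge0//=.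
  by rewrite gerBl mulr_ge0// divr_ge0 ?sqr_ge0// exprn_ge0.
rewrite ge0_integralZl_EFin//; last 2 first.
- exact/measurable_EFinP.
- by rewrite addr_ge0// mulr_ge0// ltW.
- by rewrite EFinM lee_wpmul2l// lee_fin addr_ge0// mulr_ge0// ltW.
by move=> x _; rewrite lee_fin.
Qed.

Lemma slln (h : T -> R) (a : R) :
  measurable_fun setT h -> (forall x, 0 <= h x) ->
  (\int[P]_x (h x)%:E = a%:E)%E ->
  {ae Pr, forall w, forall e, 0 < e -> \forall n \near \oo,
    `|\sum_(i < n) h (X i w) - n%:R * a| <= n%:R * e}.
Proof.
move=> mh h0 ha.
pose A m := [set x | h x <= m%:R].
have mA m : measurable (A m).
  by rewrite -[A m]setTI; exact: measurable_fun_le.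
have inA m x : (x \in A m) = (h x <= m%:R) by apply/idP/idP; rewrite inE.
pose b m x := h x * \1_(A m) x.
pose t m x := h x * \1_(~` A m) x.
have btE m x : h x = b m x + t m x.
  by rewrite /b /t -mulrDr !indicE in_setC; case: (_ \in _); rewrite /= ?addr0 ?add0r mulr1.
have mb m : measurable_fun setT (b m).
  by apply: measurable_funM => //; exact: measurable_indic.
have mt m : measurable_fun setT (t m).
  apply: measurable_funM => //; apply: measurable_indic; exact: measurableC.
have t0 m x : 0 <= t m x by rewrite mulr_ge0.
have b0 m x : 0 <= b m x <= m%:R.
  rewrite mulr_ge0//= /b indicE inA.
  by case: (leP (h x) m%:R) => ?; rewrite ?mulr1 ?mulr0.
have th m x : t m x <= h x by rewrite (btE m x) lerDr; have /andP[] := b0 m x.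
have inth : P.-integrable setT (EFin \o h).
  apply/integrableP; split; first exact/measurable_EFinP.
  under eq_integral do rewrite /= ger0_norm//.
  by rewrite ha ltry.
have t_cvg : (fun m => \int[P]_x (t m x)%:E)%E @ \oo --> (\int[P]_x (cst 0 x))%E.
  have [] // := @dominated_convergence _ _ _ P setT measurableT
    (fun m => EFin \o t m) (cst 0%E) (EFin \o h).
  - by move=> m; exact/measurable_EFinP.
  - apply: aeW => x _ /=; apply: cvg_near_cst.
    exists (Num.truncn (h x)).+1 => // m /= hm.
    rewrite /t indicE in_setC inA (_ : h x <= m%:R) ?mulr0//.
    by rewrite (le_trans (ltW (truncnS_gt _)))// ler_nat.
  - by apply: aeW => x m _ /=; rewrite lee_fin ger0_norm.
rewrite integral0 in t_cvg.
have /choice[m mP] (k : nat) : exists m, (\int[P]_x (t m x)%:E <= (k.+1%:R^-1)%:E)%E.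
  have k0 : 0 < k.+1%:R^-1 :> R by [].
  have /fine_cvgP[fin /cvgrPdist_le /(_ _ k0)] := t_cvg.
  move=> H; have [m _ /(_ m (leqnn m))[/= finm]] := filterI fin H.
  rewrite sub0r normrN => le_m; exists m.
  by rewrite -(fineK finm) lee_fin (le_trans (ler_norm _)).
have intb k : P.-integrable setT (EFin \o b (m k)).
  apply: (bounded_integrable _ _ (m k)%:R) => // x.
  by have /andP[? ?] := b0 (m k) x; rewrite ger0_norm.
have intt k : P.-integrable setT (EFin \o t (m k)).
  apply: (le_integrable _ _ _ inth) => //; first exact/measurable_EFinP.
  by move=> x _ /=; rewrite lee_fin !ger0_norm.
have tfin k : (\int[P]_x (t (m k) x)%:E)%E \is a fin_num.
  exact: (integrable_fin_num measurableT (intt k)).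
have bE k : (\int[P]_x (b (m k) x)%:E = (a - fine (\int[P]_x (t (m k) x)%:E))%:E)%E.
  rewrite EFinB fineK ?tfin// -ha.
  under [X in (_ = X - _)%E]eq_integral do rewrite (btE (m k)) EFinD.
  by rewrite integralD ?addeK ?tfin//; [exact: intb|exact: intt].
have inv0 k : 0 < k.+1%:R^-1 :> R by [].
have B := ae_foralln (fun k => slln_bounded _ _ _ (mb (m k)) (b0 (m k)) (bE k)).
have D := ae_foralln (fun k => slln_dominated _ _ _ (mt (m k)) (t0 (m k)) (mP k) (inv0 k)).
apply: filterS2 B D => w Bw Dw e e0.
have [k ke] := exists_invr_lt _ (divr_gt0 e0 (ltr0Sn R 5)).
have e6 : 0 < e / 6 by rewrite divr_gt0.
apply: filterS2 (Bw k _ e6) (Dw k) => n.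
under [in X in _ -> _ -> X]eq_bigr do rewrite (btE (m k)).
rewrite big_split/=.
set sb := \sum_(i < n) b _ _; set st := \sum_(i < n) t _ _.
have st0 : 0 <= st by rewrite sumr_ge0.
have tk := mP k; rewrite -(fineK (tfin k)) lee_fin in tk.
have : 0 <= fine (\int[P]_x (t (m k) x)%:E)%E.
  by rewrite fine_ge0// integral_ge0// => x _; rewrite lee_fin.
move: tk ke; set z := fine _; set dl := _^-1 => zd de z0.
rewrite !ler_norml => /andP[H1 H2] H3.
have H4 : n%:R * dl <= n%:R * (e / 6) by rewrite ler_wpM2l// ltW.
have H5 : n%:R * z <= n%:R * dl by rewrite ler_wpM2l.
have H6 : 0 <= n%:R * z by rewrite mulr_ge0.
by apply/andP; split; lra.
Qed.

End iid.

(** * Euclidean norms and orthonormal matrices *)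

Section norm2.
Context {R : realType}.

Lemma sum_mul_sq_le (I : finType) (a b : I -> R) :
  (\sum_i a i * b i) ^+ 2 <= (\sum_i a i ^+ 2) * (\sum_i b i ^+ 2).
Proof.
have : 0 <= \sum_i \sum_j (a i * b j - a j * b i) ^+ 2.
  by apply: sumr_ge0 => i _; apply: sumr_ge0 => j _; exact: sqr_ge0.
set A := \sum_i a i ^+ 2; set B := \sum_i b i ^+ 2; set C := \sum_i a i * b i.
have -> : \sum_i \sum_j (a i * b j - a j * b i) ^+ 2 = A * B + B * A - 2 * (C * C).
  rewrite /A /B /C !mulr_suml mulr_sumr -sumrN -!big_split/=; apply: eq_bigr => i _.
  rewrite !mulr_sumr -sumrN -!big_split/=; apply: eq_bigr => j _; ring.
by rewrite expr2; lra.
Qed.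

Lemma norm2E (m n : nat) (A : 'M[R]_(m, n)) :
  norm2 A = Num.sqrt (\sum_(z : 'I_m * 'I_n) A z.1 z.2 ^+ 2).
Proof. by rewrite /norm2 pair_big. Qed.

Lemma norm2_ge0 (m n : nat) (A : 'M[R]_(m, n)) : 0 <= norm2 A.
Proof. exact: sqrtr_ge0. Qed.

Lemma norm2_sqr (m n : nat) (A : 'M[R]_(m, n)) :
  norm2 A ^+ 2 = \sum_(z : 'I_m * 'I_n) A z.1 z.2 ^+ 2.
Proof. by rewrite norm2E sqr_sqrtr// sumr_ge0// => z _; exact: sqr_ge0. Qed.

Lemma norm20 (m n : nat) : norm2 (0 : 'M[R]_(m, n)) = 0.
Proof.
by rewrite norm2E big1 ?sqrtr0// => z _; rewrite mxE expr0n.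
Qed.

Lemma norm2N (m n : nat) (A : 'M[R]_(m, n)) : norm2 (- A) = norm2 A.
Proof.
by rewrite !norm2E; congr Num.sqrt; apply: eq_bigr => z _; rewrite mxE sqrrN.
Qed.

Lemma norm2D (m n : nat) (A B : 'M[R]_(m, n)) :
  norm2 (A + B) <= norm2 A + norm2 B.
Proof.
rewrite -(@ler_pXn2r _ 2)// ?nnegrE ?addr_ge0 ?norm2_ge0//.
rewrite sqrrD !norm2_sqr.
under eq_bigr do rewrite mxE sqrrD.
rewrite !big_split/= lerD2r lerD2l.
rewrite -mulr2n lerMn2r/=.
have := sum_mul_sq_le _ (fun z => A z.1 z.2) (fun z => B z.1 z.2).
rewrite -!norm2_sqr -exprMn => H.
apply: (le_trans (ler_norm _)).
by rewrite -(@ler_pXn2r _ 2)// ?nnegrE ?mulr_ge0 ?norm2_ge0// real_normK ?num_real.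
Qed.

Lemma norm2_distC (m n : nat) (A B : 'M[R]_(m, n)) : norm2 (A - B) = norm2 (B - A).
Proof. by rewrite -norm2N opprB. Qed.

Lemma norm2_triangle (m n : nat) (B A C : 'M[R]_(m, n)) :
  norm2 (A - C) <= norm2 (A - B) + norm2 (B - C).
Proof. by rewrite (le_trans _ (norm2D _ _ _ _))// addrA subrK. Qed.

Lemma entry_le_norm2 (m n : nat) (A : 'M[R]_(m, n)) i j : `|A i j| <= norm2 A.
Proof.
rewrite -(@ler_pXn2r _ 2)// ?nnegrE ?norm2_ge0// norm2_sqr real_normK ?num_real//.
by rewrite (bigD1 (i, j))//= lerDl sumr_ge0// => z _; exact: sqr_ge0.
Qed.

Lemma norm2_le_sum (m n : nat) (A : 'M[R]_(m, n)) :
  norm2 A <= \sum_(z : 'I_m * 'I_n) `|A z.1 z.2|.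
Proof.
rewrite -(@ler_pXn2r _ 2)// ?nnegrE ?norm2_ge0 ?sumr_ge0// norm2_sqr.
rewrite expr2 mulr_suml; apply: ler_sum => z _.
rewrite -[leLHS]real_normK ?num_real// expr2 ler_wpM2l//.
by rewrite (bigD1 z)//= lerDl sumr_ge0.
Qed.

Lemma norm2_orthonormal (p q : nat) (A : 'M[R]_(p, q)) (f : 'cV[R]_q) :
  A^T *m A = 1%:M -> norm2 (A *m f) = norm2 f.
Proof.
move=> AA.
have E m (v : 'cV[R]_m) : norm2 v = Num.sqrt ((v^T *m v) 0 0).
  rewrite /norm2 mxE; congr Num.sqrt; apply: eq_bigr => i _.
  by rewrite big_ord1 mxE expr2.
by rewrite !E trmx_mul -mulmxA (mulmxA A^T) AA mul1mx.
Qed.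

Lemma continuous_borel_measurable (p : nat) (f : 'cV[R]_p -> R) :
  continuous f -> measurable_fun setT (f : borelcV R p -> R).
Proof.
move=> cf; apply: (measurability _ (RGenOpens.measurableE R)).
move=> _ [_ [a [b ->] <-]]; rewrite setTI; apply: sub_sigma_algebra.
move/continuousP: cf; apply; exact: interval_open.
Qed.

Lemma measurable_norm2_dist (p : nat) (y : 'cV[R]_p) :
  measurable_fun setT (fun x : borelcV R p => norm2 ((x : 'cV[R]_p) - y)).
Proof.
rewrite /norm2 -[X in measurable_fun _ X]/(Num.sqrt \o
  (fun x : borelcV R p => \sum_i \sum_j ((x : 'cV[R]_p) - y) i j ^+ 2)).
apply: measurableT_comp.
  exact: continuous_measurable_fun (@sqrt_continuous R).
apply: measurable_sum => i; apply: measurable_sum => j.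
apply: measurable_funX.
have mij := continuous_borel_measurable p _ (@coord_continuous R p 1 i j).
under eq_fun do rewrite !mxE.
by apply: measurable_funB => //; exact: mij.
Qed.

End norm2.

Section orthonormal.
Context {R : realType}.

Lemma orthonormal_exists (p q : nat) : (q <= p)%N ->
  exists A : 'M[R]_(p, q), A^T *m A = 1%:M.
Proof.
move=> qp; exists (pid_mx q).
by rewrite tr_pid_mx mul_pid_mx minnn (minn_idPr qp) pid_mx_1.
Qed.

(* When [b <> y] have the same norm, the reflection exchanging them is
   [1 - 2 v v^T / |v|^2] with [v = b - y]. *)
Lemma reflection_exists (p : nat) (b y : 'cV[R]_p) : norm2 b = norm2 y ->
  exists2 H : 'M[R]_p, H^T *m H = 1%:M & H *m b = y.
Proof.
move=> bynorm; have [->|b_neq_y] := eqVneq b y.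
  by exists 1%:M; rewrite ?trmx1 mul1mx.
pose dot (u w : 'cV[R]_p) := \sum_i u i 0 * w i 0.
have dotE u w : u^T *m w = (dot u w)%:M.
  rewrite [LHS]mx11_scalar mxE; congr (_%:M).
  by apply: eq_bigr => i _; rewrite mxE.
have dotN u : dot u u = norm2 u ^+ 2.
  rewrite /norm2 sqr_sqrtr; last by do 2 apply: sumr_ge0 => ? _; exact: sqr_ge0.
  by apply: eq_bigr => i _; rewrite big_ord1 expr2.
pose v := b - y; pose s := dot v v.
have s_neq0 : s != 0.
  apply: contra b_neq_y; rewrite /s dotN sqrf_eq0 => /eqP v0.
  rewrite -subr_eq0; apply/eqP/matrixP => i j; rewrite [RHS]mxE.
  by apply/eqP; rewrite -normr_le0 -v0 entry_le_norm2.
have vb : 2 * dot v b = s.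
  have E : dot b b = dot y y by rewrite !dotN bynorm.
  have -> : s = dot b b - 2 * dot y b + dot y y.
    rewrite /s /dot mulr_sumr -sumrN -!big_split/=; apply: eq_bigr => i _.
    by rewrite !mxE; ring.
  have -> : dot v b = dot b b - dot y b.
    by rewrite /dot -sumrN -big_split/=; apply: eq_bigr => i _; rewrite !mxE; ring.
  by rewrite -E; ring.
pose c := 2 / s; pose W := v *m v^T.
have WT : W^T = W by rewrite /W trmx_mul trmxK.
have WW : W *m W = s *: W.
  by rewrite /W mulmxA -(mulmxA v) dotE mul_mx_scalar -scalemxAl.
exists (1%:M - c *: W).
  have -> : (1%:M - c *: W)^T = 1%:M - c *: W.
    by rewrite raddfB/= tr_scalar_mx linearZ/= WT.
  rewrite mulmxBl mul1mx mulmxBr mulmx1.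
  rewrite -scalemxAl -scalemxAr WW !scalerA opprB addrA.
  rewrite (_ : c * c * s = c + c); last by rewrite /c; field.
  by rewrite scalerDl addrA subrK addrK.
rewrite mulmxBl mul1mx -scalemxAl /W -mulmxA dotE mul_mx_scalar scalerA.
rewrite (_ : c * _ = 1) ?scale1r ?subKr//.
rewrite /c -{1}vb; field; rewrite -vb in s_neq0.
by move: s_neq0; rewrite mulf_eq0 negb_or => /andP[].
Qed.

Lemma orthonormal_range (p q : nat) (y : 'cV[R]_p) : (0 < q)%N -> (q <= p)%N ->
  exists (A : 'M[R]_(p, q)) (f : 'cV[R]_q), A^T *m A = 1%:M /\ A *m f = y.
Proof.
move=> q0 qp; have [A AA] := orthonormal_exists _ _ qp.
pose f : 'cV[R]_q := norm2 y *: delta_mx (Ordinal q0) 0.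
have fy : norm2 f = norm2 y.
  apply/eqP; rewrite -(@eqrXn2 _ 2)// ?norm2_ge0// [eqbLHS]norm2_sqr.
  rewrite (bigD1 (Ordinal q0, 0))//= big1 ?addr0; last first.
    move=> [i j]/= ij; rewrite !mxE (_ : _ && _ = false) ?mulr0 ?expr0n//.
    by apply: contraNF ij => /andP[/eqP -> /eqP ->].
  by rewrite !mxE !eqxx mulr1.
have [|H HH Hy] := reflection_exists _ (A *m f) y.
  by rewrite norm2_orthonormal.
exists (H *m A), f; split; last by rewrite -mulmxA.
by rewrite trmx_mul -mulmxA (mulmxA H^T) HH mul1mx.
Qed.
End orthonormal.

(** * Risk and distances between parameters *)

Section extrema.
Context {R : realType} {I : choiceType}.
Implicit Types (s : seq I) (u : I -> \bar R) (z : \bar R).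
Local Open Scope ereal_scope.

Lemma le_bigmine s u z : (forall i, i \in s -> z <= u i) ->
  z <= \big[mine/+oo]_(i <- s) u i.
Proof.
elim: s => [|i s IH] zu; first by rewrite big_nil leey.
rewrite big_cons le_min zu ?mem_head//= IH// => j js.
by rewrite zu// inE js orbT.
Qed.

Lemma bigmine_le s u i : i \in s -> \big[mine/+oo]_(j <- s) u j <= u i.
Proof.
elim: s => // j s IH; rewrite inE big_cons ge_min => /predU1P[->|/IH ->].
  by rewrite lexx.
by rewrite orbT.
Qed.

Lemma bigmaxe_le s u z : (forall i, i \in s -> u i <= z) ->
  \big[maxe/-oo]_(i <- s) u i <= z.
Proof.
elim: s => [|i s IH] zu; first by rewrite big_nil leNye.
rewrite big_cons ge_max zu ?mem_head//= IH// => j js.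
by rewrite zu// inE js orbT.
Qed.

Lemma le_bigmaxe s u i : i \in s -> u i <= \big[maxe/-oo]_(j <- s) u j.
Proof.
elim: s => // j s IH; rewrite inE big_cons le_max => /predU1P[->|/IH ->].
  by rewrite lexx.
by rewrite orbT.
Qed.

Lemma measurable_bigmine d (T : measurableType d) s (u : I -> T -> \bar R) :
  (forall i, measurable_fun setT (u i)) ->
  measurable_fun setT (fun x => \big[mine/+oo]_(i <- s) u i x).
Proof.
move=> mu; elim: s => [|i s IH].
  by under eq_fun do rewrite big_nil; exact: measurable_cst.
by under eq_fun do rewrite big_cons; exact: measurable_mine.
Qed.
End extrema.

Section hausdorff.
Context {R : realType} {q : nat}.
Local Open Scope ereal_scope.

Lemma hausdorff_ge0 (F G : {fset 'cV[R]_q}) : F != fset0 ->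
  0 <= hausdorff F G.
Proof.
move=> /fset0Pn[f fF]; rewrite /hausdorff le_max; apply/orP; left.
apply: le_trans (le_bigmaxe _ _ _ fF); apply: le_bigmine => g _.
by rewrite lee_fin norm2_ge0.
Qed.

Lemma hausdorff_le (F G : {fset 'cV[R]_q}) (e : R) :
  (forall f, f \in F -> exists2 g, g \in G & (norm2 (f - g) <= e)%R) ->
  (forall g, g \in G -> exists2 f, f \in F & (norm2 (g - f) <= e)%R) ->
  hausdorff F G <= e%:E.
Proof.
move=> FG GF; rewrite /hausdorff ge_max; apply/andP; split.
  apply: bigmaxe_le => f /FG[g gG fg].
  by apply: le_trans (bigmine_le _ _ _ gG) _; rewrite lee_fin.
apply: bigmaxe_le => g /GF[f fF gf].
by apply: le_trans (bigmine_le _ _ _ fF) _; rewrite lee_fin.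
Qed.

Lemma pdist_ge0 (p : nat) (th th' : param R p q) : th.1 != fset0 ->
  0 <= pdist th th'.
Proof.
by move=> th0; rewrite adde_ge0 ?hausdorff_ge0// lee_fin norm2_ge0.
Qed.

Lemma pdist_xx (p : nat) (th : param R p q) : th.1 != fset0 -> pdist th th = 0.
Proof.
move=> th0; apply/eqP; rewrite eq_le pdist_ge0// andbT.
rewrite /pdist subrr norm20 adde0.
by apply: hausdorff_le => f fF; exists f; rewrite // subrr norm20.
Qed.

Lemma pdist_set_ge0 (p : nat) (th : param R p q) (S : set (param R p q)) :
  th.1 != fset0 -> 0 <= pdist_set th S.
Proof.
by move=> th0; apply/ereal_infP => _ [th' _ <-]; exact: pdist_ge0.
Qed.

Lemma pdist_set_le (p : nat) (th th' : param R p q) (S : set (param R p q)) :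
  S th' -> pdist_set th S <= pdist th th'.
Proof. by move=> Sth'; apply: ereal_inf_lbound; exists th'. Qed.
End hausdorff.

Section risk.
Context {R : realType} {p q : nat} {phi : R -> R}.
Context (phi_ge0 : forall r : R, 0 <= phi r) (phi_continuous : continuous phi).
Implicit Types th : param R p q.
Local Notation loss th := (fun x : borelcV R p =>
  (\big[mine/+oo]_(f <- th.1) (phi (norm2 ((x : 'cV[R]_p) - th.2 *m f)))%:E)%E).

Lemma measurable_phi_dist (y : 'cV[R]_p) :
  measurable_fun setT (fun x : borelcV R p => phi (norm2 ((x : 'cV[R]_p) - y))).
Proof.
apply: (measurableT_comp (continuous_measurable_fun phi_continuous)).
exact: measurable_norm2_dist.
Qed.

Lemma measurable_loss th : measurable_fun setT (loss th).
Proof.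
by apply: measurable_bigmine => f; apply/measurable_EFinP; exact: measurable_phi_dist.
Qed.

Lemma loss_ge0 th x : (0 <= loss th x)%E.
Proof. by apply: le_bigmine => f _; rewrite lee_fin. Qed.

Lemma loss_fin_num th x : th.1 != fset0 -> loss th x \is a fin_num.
Proof.
move=> /fset0Pn[f fth]; rewrite ge0_fin_numE ?loss_ge0//.
exact: le_lt_trans (bigmine_le _ _ _ fth) (ltry _).
Qed.

Lemma Phi_ge0 th (Q : {measure set (borelcV R p) -> \bar R}) : (0 <= Phi phi th Q)%E.
Proof. by apply: integral_ge0 => x _; exact: loss_ge0. Qed.

Lemma minrisk_ge0 k (Q : {measure set (borelcV R p) -> \bar R}) :
  (0 <= minrisk q phi k Q)%E.
Proof. by apply/ereal_infP => _ [th _ <-]; exact: Phi_ge0. Qed.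

Lemma minrisk_le k th (Q : {measure set (borelcV R p) -> \bar R}) :
  Xi k th -> (minrisk q phi k Q <= Phi phi th Q)%E.
Proof. by move=> Xth; apply: ereal_inf_lbound; exists th. Qed.

End risk.

Lemma integral_le_liminf {R : realType} {d} {T : measurableType d}
    (mu : {measure set T -> \bar R}) (g : T -> R) (h : nat -> T -> R) (b : R) :
  measurable_fun setT g -> (forall n, measurable_fun setT (h n)) ->
  (forall x, 0 <= g x) -> (forall n x, 0 <= h n x) ->
  (forall n, (\int[mu]_x (h n x)%:E <= b%:E)%E) ->
  (forall x e, 0 < e -> \forall n \near \oo, g x <= h n x + e) ->
  (\int[mu]_x (g x)%:E <= b%:E)%E.
Proof.
move=> mg mh g0 h0 hb gh.
pose f n x := Num.min (g x) (h n x).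
have mf n : measurable_fun setT (fun x => (f n x)%:E).
  by apply/measurable_EFinP; exact: measurable_minr.
have f0 n x : (0 <= (f n x)%:E)%E by rewrite lee_fin le_min g0 h0.
have := fatou mu measurableT mf (fun n x _ => f0 n x).
have -> : (\int[mu]_x limn_einf (fun n => (f n x)%:E) = \int[mu]_x (g x)%:E)%E.
  apply: eq_integral => x _; apply: (cvg_limn_einf_sup _).1.
  apply: cvg_EFin; first exact: nearW.
  apply/cvgrPdist_le => e e0; apply: filterS (gh x e e0) => n ge.
  by rewrite /f/= ger0_norm ?subr_ge0 ?ge_min ?lexx// minEle; case: ifP; lra.
move=> /le_trans; apply; rewrite limn_einf_lim.
apply: lime_le; first exact: is_cvg_einfs.
apply: nearW => n; apply: (@le_trans _ _ (\int[mu]_x (f n x)%:E)%E).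
  by apply: ereal_inf_lbound; exists n => /=.
apply: le_trans (hb n); apply: ge0_le_integral => //.
- exact/measurable_EFinP.
- by move=> x _; rewrite lee_fin ge_min lexx orbT.
Qed.

Section ultrafilter.
Context {R : realType}.

Lemma near_ultra (T : Type) (F : set_system T) {FF : Filter F} (A : set T) :
  (forall U : set_system T, UltraFilter U -> F `<=` U -> U A) -> F A.
Proof.
move=> H; apply: contrapT => nFA.
have PF : ProperFilter (within (~` A) F).
  apply: Build_ProperFilter_ex => B HB.
  rewrite /within/= in HB.
  apply: contrapT => /forallNP nB; apply: nFA.
  by apply: filterS HB => x xB; apply: contrapT => /xB; exact: nB.
have [U [UU FU]] := ultraFilterLemma PF.
have UP := @ultra_proper _ _ UU.
have UA : U A by apply: H => // B FB; apply: FU; apply: filterS FB.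
have UnA : U (~` A) by apply: FU; exact: (@nearW _ F).
by have [x []] := filter_ex (filterI UA UnA).
Qed.

Lemma ultra_bounded_cvg (T : Type) (U : set_system T) (u : T -> R) (M : R) :
  UltraFilter U -> U [set n | `|u n| <= M] ->
  exists l, forall e, 0 < e -> U [set n | `|u n - l| < e].
Proof.
move=> UU UM; have UP := @ultra_proper _ _ UU.
have uUM : U (u @^-1` `[- M, M]%classic).
  by apply: filterS UM => n /= nM; rewrite in_itv/= -ler_norml.
have [l [_ ul]] := @segment_compact R (- M) M (u @ U) _ uUM.
exists l => e e0.
have [//|UnA] := in_ultra_setVsetC [set n | `|u n - l| < e] UU.
have uUe : U (u @^-1` [set y | e <= `|y - l|]).
  by apply: filterS UnA => n /= /negP; rewrite -leNgt.
have [y [/= ye]] := ul _ _ uUe (nbhsx_ballx l e e0).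
by rewrite /ball/= distrC ltNge ye.
Qed.
End ultrafilter.

(** * Limits of parameters along an ultrafilter *)

Section surrogate.
Context {R : realType} {p : nat}.

Lemma rat_vector_dense (y : 'cV[R]_p) (e : R) : 0 < e ->
  exists z : 'cV[rat]_p, norm2 (y - map_mx ratr z) < e.
Proof.
move=> e0; pose dl := e / p.+1%:R.
have dl0 : 0 < dl by rewrite divr_gt0.
have /choice[f fP] (i : 'I_p) : exists z : rat, `|y i 0 - ratr z| < dl.
  have : y i 0 - dl < y i 0 + dl by lra.
  move=> /rat_in_itvoo[z]; rewrite in_itv/= => /andP[z1 z2]; exists z.
  by rewrite ltr_norml; apply/andP; split; lra.
exists (\col_i f i); apply: (le_lt_trans (norm2_le_sum _ _ _)).
apply: (@le_lt_trans _ _ (\sum_(z : 'I_p * 'I_1) dl)).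
  by apply: ler_sum => -[i j] _; rewrite !mxE/= (ord1 j) ltW.
rewrite sumr_const card_prod !card_ord muln1 /dl -[_ *+ p]mulr_natr mulrAC -mulrA.
by rewrite gtr_pMr// ltr_pdivrMr// mul1r ltr_nat.
Qed.

(* [Some y] bounds from below the distance to any centre within [2 / r.+1]
   of [y], and [None] the distance to any centre of norm at least [r]. *)
Definition dist_lower (o : option 'cV[rat]_p) (r : nat) (x : 'cV[R]_p) : R :=
  if o is Some y then norm2 (x - map_mx ratr y) - 2 / r.+1%:R
  else r%:R - norm2 x.

Definition surrogate (phi : R -> R) (k : nat)
    (t : {ffun 'I_k -> option 'cV[rat]_p}) (r : nat) (x : borelcV R p) : R :=
  \big[Num.min/r%:R]_(i < k) phi (dist_lower (t i) r (x : 'cV[R]_p)).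

Lemma dist_lower_le (o : option 'cV[rat]_p) (r : nat) (x c : 'cV[R]_p) :
  (if o is Some y then norm2 (c - map_mx ratr y) <= 2 / r.+1%:R
   else r%:R <= norm2 c) ->
  dist_lower o r x <= norm2 (x - c).
Proof.
case: o => [y|] /=.
  by have := norm2_triangle _ _ c x (map_mx ratr y); move: (2 / _) => e; lra.
have := norm2_triangle _ _ x c 0; rewrite !subr0 norm2_distC; lra.
Qed.

Context {phi : R -> R} (phi_ge0 : forall r : R, 0 <= phi r)
  (phi_continuous : continuous phi).

Lemma surrogate_bounds k (t : {ffun 'I_k -> option 'cV[rat]_p}) r x :
  0 <= surrogate phi k t r x <= r%:R.
Proof. by rewrite bigmin_le_id andbT le_bigmin. Qed.

Lemma measurable_surrogate k (t : {ffun 'I_k -> option 'cV[rat]_p}) r :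
  measurable_fun setT (surrogate phi k t r).
Proof.
rewrite /surrogate; elim: (index_enum _) => [|i s IH].
  by under eq_fun do rewrite big_nil; exact: measurable_cst.
under eq_fun do rewrite big_cons; apply: measurable_minr => //.
apply: (measurableT_comp (continuous_measurable_fun phi_continuous)).
rewrite /dist_lower; case: (t i) => [y|].
  by apply: measurable_funB => //; exact: measurable_norm2_dist.
apply: measurable_funB => //.
by have := @measurable_norm2_dist R p 0; under eq_fun do rewrite subr0.
Qed.
End surrogate.

Lemma fset_surj_ord (K : choiceType) (k : nat) (F : {fset K}) :
  F != fset0 -> (#|` F| <= k)%N ->
  exists g : 'I_k -> K, (forall i, g i \in F) /\
    forall f, f \in F -> exists i, g i = f.
Proof.
move=> /fset0Pn[f0 f0F] Fk; exists (fun i => nth f0 F i); split.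
  move=> i; have [iF|Fi] := ltnP i (size F); first exact: mem_nth.
  by rewrite nth_default.
move=> f fF; have iF : (index f F < size F)%N by rewrite index_mem.
by exists (Ordinal (leq_trans iF Fk)); rewrite /= nth_index.
Qed.

Section surrogate_liminf.
Context {R : realType} {p k : nat} {phi : R -> R}.
Context (phi_nondecreasing : {homo phi : r s / r <= s})
  (phi_continuous : continuous phi).

Lemma near_ge_nat (a : R) : \forall r \near \oo, a <= r%:R.
Proof.
exists (Num.truncn a).+1 => // r /= ar.
by rewrite (le_trans (ltW (truncnS_gt _)))// ler_nat.
Qed.

Lemma near_invS_lt (e : R) : 0 < e -> \forall r \near \oo, r.+1%:R^-1 < e.
Proof.
move=> /exists_invr_lt[N Ne]; exists N => // r /= Nr.
by rewrite (le_lt_trans _ Ne)// lef_pV2 ?posrE// ler_nat.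
Qed.

Lemma surrogate_liminf (s : 'I_k -> option 'cV[R]_p)
    (t : nat -> {ffun 'I_k -> option 'cV[rat]_p}) (x : 'cV[R]_p) (v : R) :
  (forall r i, if s i is Some c then
     exists2 y, t r i = Some y & norm2 (c - map_mx ratr y) < r.+1%:R^-1
   else t r i = None) ->
  (forall i c, s i = Some c -> v <= phi (norm2 (x - c))) ->
  (exists L, v <= phi L) ->
  forall e, 0 < e -> \forall r \near \oo, v <= surrogate phi k (t r) r x + e.
Proof.
move=> tP sv [L vL] e e0.
suff : \forall r \near \oo, forall i, v - e <= phi (dist_lower (t r i) r x).
  apply: filterS2 (near_ge_nat v) => r vr H.
  by rewrite -lerBlDr le_bigmin// (le_trans _ vr)// gerBl ltW.
apply: filter_forall => i; case si : (s i) => [c|].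
  have [dl dl0 Hdl] : exists2 dl, 0 < dl &
      forall z, `|norm2 (x - c) - z| < dl -> `|phi (norm2 (x - c)) - phi z| < e.
    have /cvgrPdist_lt/(_ e e0) phi_near := phi_continuous (norm2 (x - c)).
    have /nbhs_ballP[dl dl0 dlP] := phi_near.
    by exists dl => // z zdl; exact: dlP.
  apply: filterS (near_invS_lt _ (divr_gt0 dl0 (ltr0Sn R 2))) => r r_dl.
  have := tP r i; rewrite si => -[y -> yc] /=.
  have r0 : 0 < r.+1%:R^-1 :> R by [].
  set a := r.+1%:R^-1 in r_dl yc r0 *.
  have D : norm2 (x - c) - 3 * a <= norm2 (x - map_mx ratr y) - 2 * a.
    have := norm2_triangle _ _ (map_mx ratr y) x c.
    by rewrite (norm2_distC _ _ (map_mx ratr y) c); lra.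
  apply: le_trans (phi_nondecreasing _ _ D).
  have /Hdl : `|norm2 (x - c) - (norm2 (x - c) - 3 * a)| < dl.
    by rewrite opprB addrC subrK ger0_norm; lra.
  by have := sv i c si; rewrite ltr_norml; lra.
apply: filterS (near_ge_nat (L + norm2 x)) => r rL.
have := tP r i; rewrite si => -> /=.
apply: (@le_trans _ _ (phi L)); first lra.
by apply: phi_nondecreasing; lra.
Qed.
End surrogate_liminf.

Section matrix_limits.
Context {R : realType}.

Lemma norm2_sqr_sum (m n : nat) (A : 'M[R]_(m, n)) :
  norm2 A ^+ 2 = \sum_i \sum_j A i j ^+ 2.
Proof. by rewrite norm2_sqr (pair_big xpredT xpredT). Qed.

Lemma norm2M (m n r : nat) (A : 'M[R]_(m, n)) (B : 'M[R]_(n, r)) :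
  norm2 (A *m B) <= norm2 A * norm2 B.
Proof.
rewrite -(@ler_pXn2r _ 2)// ?nnegrE ?mulr_ge0 ?norm2_ge0//.
rewrite exprMn !norm2_sqr_sum (exchange_big _ _ _ _ _ (fun i j => B i j ^+ 2))/=.
rewrite mulr_suml.
apply: ler_sum => i _; rewrite mulr_sumr; apply: ler_sum => j _.
by rewrite mxE; exact: sum_mul_sq_le.
Qed.

Lemma norm2_tr (m n : nat) (A : 'M[R]_(m, n)) : norm2 A^T = norm2 A.
Proof.
rewrite /norm2 exchange_big; congr Num.sqrt.
by apply: eq_bigr => i _; apply: eq_bigr => j _; rewrite mxE.
Qed.

Lemma norm2_le0 (m n : nat) (A : 'M[R]_(m, n)) : norm2 A <= 0 -> A = 0.
Proof.
move=> A0; apply/matrixP => i j; rewrite mxE; apply/eqP.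
by rewrite -normr_le0 (le_trans (entry_le_norm2 _ _ _ _ _)).
Qed.

Lemma norm2_orthonormal_sqr (p q : nat) (A : 'M[R]_(p, q)) :
  A^T *m A = 1%:M -> norm2 A ^+ 2 = q%:R.
Proof.
move=> AA; transitivity (\tr (A^T *m A)); last by rewrite AA mxtrace1.
rewrite norm2_sqr_sum /mxtrace exchange_big/=; apply: eq_bigr => j _; rewrite mxE.
by apply: eq_bigr => i _; rewrite mxE expr2.
Qed.

Context {T : Type} {U : set_system T} (UU : UltraFilter U).
Let UP := @ultra_proper _ _ UU.

Lemma matrix_ultra_cvg (m n : nat) (u : T -> 'M[R]_(m, n)) (M : R) :
  U [set w | norm2 (u w) <= M] ->
  exists A, forall e, 0 < e -> U [set w | norm2 (u w - A) < e].
Proof.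
move=> uM.
have /choice[a aP] (z : 'I_m * 'I_n) :
    exists l, forall e, 0 < e -> U [set w | `|u w z.1 z.2 - l| < e].
  apply: (@ultra_bounded_cvg _ _ _ _ M) => //; apply: filterS uM => w /= uwM.
  exact: le_trans (entry_le_norm2 _ _ _ _ _) uwM.
exists (\matrix_(i, j) a (i, j)) => e e0.
pose dl := e / (m * n).+1%:R.
have dl0 : 0 < dl by rewrite divr_gt0.
have H : U [set w | forall z, `|u w z.1 z.2 - a z| < dl].
  by apply: filter_forall => z; exact: aP.
apply: filterS H => w /= H; apply: (le_lt_trans (norm2_le_sum _ _ _)).
apply: (@le_lt_trans _ _ (\sum_(z : 'I_m * 'I_n) dl)).
  by apply: ler_sum => -[i j] _; rewrite !mxE/= (ltW (H (i, j))).
rewrite sumr_const card_prod !card_ord /dl -[_ *+ (m * n)]mulr_natr mulrAC -mulrA.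
by rewrite gtr_pMr// ltr_pdivrMr// mul1r ltr_nat.
Qed.

Lemma orthonormal_closed (p q : nat) (u : T -> 'M[R]_(p, q)) (A : 'M[R]_(p, q)) :
  U [set w | (u w)^T *m u w = 1%:M] ->
  (forall e, 0 < e -> U [set w | norm2 (u w - A) < e]) -> A^T *m A = 1%:M.
Proof.
move=> u1 uA; apply/eqP; rewrite -subr_eq0; apply/eqP/norm2_le0.
pose K := norm2 A + Num.sqrt q%:R.
have K0 : 0 <= K by rewrite addr_ge0 ?norm2_ge0 ?sqrtr_ge0.
apply/ler_addgt0Pl => e e0; rewrite addr0.
have dl0 : 0 < e / (K + 1) by rewrite divr_gt0// ltr_pwDr.
have [w [/= w1 wA]] := filter_ex (filterI u1 (uA _ dl0)).
have nw : norm2 (u w) = Num.sqrt q%:R.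
  by rewrite -(norm2_orthonormal_sqr _ _ _ w1) sqrtr_sqr ger0_norm ?norm2_ge0.
rewrite norm2_distC in wA.
have -> : A^T *m A - 1%:M = A^T *m (A - u w) + (A - u w)^T *m u w.
  by rewrite -w1 mulmxBr linearB/= mulmxBl addrA subrK.
apply: (le_trans (norm2D _ _ _ _)).
apply: (@le_trans _ _ (K * (e / (K + 1)))).
  rewrite /K mulrDl lerD//; apply: (le_trans (norm2M _ _ _ _ _)).
    by rewrite norm2_tr ler_wpM2l ?norm2_ge0// ltW.
  by rewrite norm2_tr nw mulrC ler_wpM2l ?sqrtr_ge0// ltW.
have K1 : 0 < K + 1 by rewrite ltr_pwDr.
by rewrite mulrCA ler_piMr ?(ltW e0)// ler_pdivrMr ?mul1r ?lerDl.
Qed.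
End matrix_limits.

Section limit_parameter.
Context {R : realType} {p q k : nat} {phi : R -> R}.
Context (phi_ge0 : forall r : R, 0 <= phi r)
  (phi_nondecreasing : {homo phi : r s / r <= s})
  (phi_continuous : continuous phi).
Context {P : probability (borelcV R p) R}.
Context (risk_gap : forall j, (1 <= j <= k.-1)%N ->
  (minrisk q phi k P < minrisk q phi j P)%E).

Lemma surrogate_le_loss (t : {ffun 'I_k -> option 'cV[rat]_p}) (r : nat)
    (th : param R p q) (c : 'I_k -> 'cV[R]_q) (x : borelcV R p) :
  (forall f, f \in th.1 -> exists i, c i = f) ->
  (forall i, if t i is Some y then norm2 (th.2 *m c i - map_mx ratr y) <= 2 / r.+1%:R
     else r%:R <= norm2 (th.2 *m c i)) ->
  ((surrogate phi k t r x)%:E <= \big[mine/+oo]_(f <- th.1)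
     (phi (norm2 ((x : 'cV[R]_p) - th.2 *m f)))%:E)%E.
Proof.
move=> c_onto ct; apply: le_bigmine => _ /c_onto[i <-]; rewrite lee_fin.
apply: (@le_trans _ _ (phi (dist_lower (t i) r (x : 'cV[R]_p)))).
  exact: bigmin_le_cond.
by apply: phi_nondecreasing; apply: dist_lower_le; exact: ct.
Qed.

Lemma limit_parameter (U : set_system nat)
    (Q : nat -> {measure set (borelcV R p) -> \bar R})
    (th : nat -> param R p q) (b : R) :
  UltraFilter U ->
  (forall t r e, 0 < e -> U [set n | (\int[P]_x (surrogate phi k t r x)%:E <=
     \int[Q n]_x (surrogate phi k t r x)%:E + e%:E)%E]) ->
  U [set n | Xi k (th n)] ->
  (forall e, 0 < e -> U [set n | (Phi phi (th n) (Q n) <= (b + e)%:E)%E]) ->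
  (b%:E <= minrisk q phi k P)%E -> (exists L, b < phi L) ->
  exists th' : param R p q, [/\ Xi k th', (Phi phi th' P <= b%:E)%E &
    forall e, 0 < e -> U [set n | (pdist (th n) th' <= e%:E)%E]].
Proof.
move=> UU HQ th_Xi th_b b_min [L bL]; have UP := @ultra_proper _ _ UU.
have /choice[c cP] (n : nat) : exists g : 'I_k -> 'cV[R]_q, Xi k (th n) ->
    (forall i, g i \in (th n).1) /\ forall f, f \in (th n).1 -> exists i, g i = f.
  have [[F0 Fk _]|nX] := pselect (Xi k (th n)).
    by have [g gP] := fset_surj_ord _ _ _ F0 Fk; exists g.
  by exists (fun=> 0).
have [A A_lim] : exists A, forall e, 0 < e -> U [set n | norm2 ((th n).2 - A) < e].
  apply: (matrix_ultra_cvg UU _ _ _ (Num.sqrt q%:R)).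
  apply: filterS th_Xi => n [_ _ AA].
  by rewrite /= -(norm2_orthonormal_sqr _ _ _ AA) sqrtr_sqr ger0_norm ?norm2_ge0.
have AA : A^T *m A = 1%:M.
  apply: (orthonormal_closed UU _ _ (fun n => (th n).2)) => //.
  by apply: filterS th_Xi => n [].
have /choice[s sP] (i : 'I_k) : exists o : option 'cV[R]_q,
    if o is Some f then forall e, 0 < e -> U [set n | norm2 (c n i - f) < e]
    else forall M, U [set n | M <= norm2 (c n i)].
  have [esc|/existsNP[M nM]] := pselect (forall M, U [set n | M <= norm2 (c n i)]).
    by exists None.
  have cM : U (~` [set n | M <= norm2 (c n i)]).
    by have [|//] := in_ultra_setVsetC [set n | M <= norm2 (c n i)] UU.
  have cM' : U [set n | norm2 (c n i) <= M].
    by apply: filterS cM => n /= /negP; rewrite -ltNge => /ltW.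
  have [f fP] := matrix_ultra_cvg UU _ _ (fun n => c n i) M cM'.
  by exists (Some f).
have Ac_lim i f : s i = Some f -> forall e, 0 < e ->
    U [set n | norm2 ((th n).2 *m c n i - A *m f) < e].
  move=> sif e e0; have := sP i; rewrite sif => cf.
  have e2 : 0 < e / 2 by rewrite divr_gt0.
  have f1 : 0 < norm2 f + 1 by rewrite ltr_pwDr// norm2_ge0.
  have Af := A_lim _ (divr_gt0 e2 f1).
  apply: filterS (filterI th_Xi (filterI Af (cf _ e2))).
  move=> n /= [[_ _ nAA] [An cn]].
  have -> : (th n).2 *m c n i - A *m f =
      (th n).2 *m (c n i - f) + ((th n).2 - A) *m f.
    by rewrite mulmxBr mulmxBl addrA subrK.
  apply: (le_lt_trans (norm2D _ _ _ _)); rewrite norm2_orthonormal//.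
  rewrite [ltRHS]splitr; apply: ltr_leD => //; apply: (le_trans (norm2M _ _ _ _ _)).
  apply: (@le_trans _ _ (e / 2 / (norm2 f + 1) * norm2 f)).
    by rewrite ler_wpM2r ?norm2_ge0// ltW.
  by rewrite -mulrA mulrC ler_piMl ?(ltW e2)// mulrC ler_pdivrMr// mul1r lerDl.
have /choice[t0 t0P] (ri : nat * 'I_k) : exists o : option 'cV[rat]_p,
    if s ri.2 is Some f then
      exists2 y, o = Some y & norm2 (A *m f - map_mx ratr y) < ri.1.+1%:R^-1
    else o = None.
  case: (s ri.2) => [f|]; last by exists None.
  have r0 : 0 < ri.1.+1%:R^-1 :> R by [].
  by have [y yP] := rat_vector_dense (A *m f) _ r0; exists (Some y); exists y.
pose t r : {ffun 'I_k -> option 'cV[rat]_p} := [ffun i => t0 (r, i)].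
pose sA i := omap (mulmx A) (s i).
have tP r i : if sA i is Some y0 then
    exists2 y, t r i = Some y & norm2 (y0 - map_mx ratr y) < r.+1%:R^-1
    else t r i = None.
  by rewrite /sA ffunE; have := t0P (r, i); rewrite /=; case: (s i).
have t_b r : (\int[P]_x (surrogate phi k (t r) r x)%:E <= b%:E)%E.
  apply/lee_addgt0Pr => e e0; have e2 : 0 < e / 2 by rewrite divr_gt0.
  have near_c : U [set n | forall i,
      if t r i is Some y then norm2 ((th n).2 *m c n i - map_mx ratr y) <= 2 / r.+1%:R
      else r%:R <= norm2 (c n i)].
    apply: filter_forall => i; have := tP r i; have := sP i; rewrite /sA.
    case si : (s i) => [f|] /=; last by move=> cM ->; exact: cM.
    move=> cf [y -> fy]; have r0 : 0 < r.+1%:R^-1 :> R by [].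
    apply: filterS (Ac_lim i f si _ r0) => n /= nf.
    have := norm2_triangle _ _ (A *m f) ((th n).2 *m c n i) (map_mx ratr y).
    by move: (r.+1%:R^-1) fy nf => a; lra.
  have [n [/= nX [nQ [nb nc]]]] :=
    filter_ex (filterI th_Xi (filterI (HQ (t r) r _ e2) (filterI (th_b _ e2) near_c))).
  apply: (le_trans nQ).
  have -> : (b%:E + e%:E = (b + e / 2)%:E + (e / 2)%:E)%E.
    by rewrite -!EFinD -addrA -splitr.
  apply: leeD2r.
  apply: le_trans nb; rewrite /Phi; apply: ge0_le_integral => //.
  - by move=> x _; rewrite lee_fin; have /andP[] := surrogate_bounds phi_ge0 _ (t r) r x.
  - by apply/measurable_EFinP; exact: measurable_surrogate.
  - exact: measurable_loss.
  - move=> x _; have [_ c_onto] := cP n nX; apply: (surrogate_le_loss _ _ _ (c n)) => // i.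
    by have := nc i; case: (t r i) => // ?; case: nX => _ _ nAA; rewrite norm2_orthonormal.
have fatou_bound (g : borelcV R p -> R) : measurable_fun setT g ->
    (forall x, 0 <= g x) ->
    (forall x i f, s i = Some f -> g x <= phi (norm2 ((x : 'cV[R]_p) - A *m f))) ->
    (forall x, exists L, g x <= phi L) -> (\int[P]_x (g x)%:E <= b%:E)%E.
  move=> mg g0 gs gL.
  apply: (integral_le_liminf _ _ (fun r => surrogate phi k (t r) r)) => //.
  - by move=> r; exact: measurable_surrogate.
  - by move=> r x; have /andP[] := surrogate_bounds phi_ge0 _ (t r) r x.
  - move=> x e e0; apply: (surrogate_liminf phi_nondecreasing phi_continuous sA
      t x (g x) _ _ (gL x) e e0).
      by move=> r i; have := tP r i; case: (sA i).
    by move=> i y; rewrite /sA; case si : (s i) => [f|//] [<-]; exact: (gs x i).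
pose F : {fset 'cV[R]_q} := [fset f | f in pmap s (enum 'I_k)]%fset.
have FP f : reflect (exists i, s i = Some f) (f \in F).
  rewrite in_fset /= mem_pmap; apply: (iffP mapP) => [[i _ ->]|[i si]]; exists i => //.
  by rewrite mem_enum.
have size_pmap_s : (size (pmap s (enum 'I_k)) <= k)%N.
  by rewrite size_pmap (leq_trans (count_size _ _))// size_enum_ord.
have F_size : (#|` F| <= size (pmap s (enum 'I_k)))%N.
  by rewrite /F card_fseq size_undup.
have F0 : F != fset0.
  apply/negP => /eqP F0; have sN i f : s i <> Some f.
    by move=> si; have /FP : exists i, s i = Some f; [exists i|rewrite F0 inE].
  have : (\int[P]_x (cst (phi L) x)%:E <= b%:E)%E.
    by apply: fatou_bound => // [x|x i f /sN//|x]; [exact: phi_ge0|exists L].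
  by rewrite integral_prob_cst lee_fin leNgt bL.
pose th' : param R p q := (F, A).
have [f0 f0F] := fset0Pn _ F0.
have th'_b : (Phi phi th' P <= b%:E)%E.
  pose g (x : borelcV R p) := fine (\big[mine/+oo]_(f <- F)
    (phi (norm2 ((x : 'cV[R]_p) - A *m f)))%:E)%E.
  have gE x : (g x)%:E = (\big[mine/+oo]_(f <- F)
      (phi (norm2 ((x : 'cV[R]_p) - A *m f)))%:E)%E.
    by rewrite /g fineK//; exact: (loss_fin_num phi_ge0 th').
  have g_le x f : f \in F -> g x <= phi (norm2 ((x : 'cV[R]_p) - A *m f)).
    by move=> fF; rewrite -lee_fin gE; exact: bigmine_le.
  rewrite /Phi; under eq_integral do rewrite -gE.
  apply: fatou_bound.
  - apply/measurable_EFinP; apply: eq_measurable_fun (measurable_loss phi_continuous th').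
    by move=> x _; rewrite -gE.
  - by move=> x; rewrite -lee_fin gE; exact: (loss_ge0 phi_ge0 th').
  - by move=> x i f si; apply: g_le; apply/FP; exists i.
  - by move=> x; exists (norm2 ((x : 'cV[R]_p) - A *m f0)); exact: g_le.
have th'_Xi j : (#|` F| <= j)%N -> Xi j th' by move=> Fj; split.
have F_card : #|` F| = k.
  apply/eqP; rewrite eqn_leq (leq_trans F_size size_pmap_s) leqNgt/=.
  apply/negP => Fk.
  have := risk_gap #|` F| _; rewrite cardfs_gt0 F0/= -ltnS (ltn_predK Fk) => /(_ Fk).
  apply/negP; rewrite -leNgt; apply: le_trans b_min; apply: le_trans th'_b.
  by apply: minrisk_le; exact: th'_Xi.
have s_some i : exists2 f, s i = Some f & f \in F.
  have : all (fun i => isSome (s i)) (enum 'I_k).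
    rewrite all_count -size_pmap size_enum_ord eqn_leq size_pmap_s/=.
    by rewrite -{1}F_card.
  move=> /allP/(_ i); rewrite mem_enum => /(_ isT).
  by case si : (s i) => [f|//] _; exists f => //; apply/FP; exists i.
exists th'; split => //; first by apply: th'_Xi; rewrite F_card.
move=> e e0; have e2 : 0 < e / 2 by rewrite divr_gt0.
have near_c : U [set n | forall i, exists2 f, s i = Some f & norm2 (c n i - f) < e / 2].
  apply: filter_forall => i; have [f si _] := s_some i.
  have := sP i; rewrite si => cf; apply: filterS (cf _ e2) => n nf.
  by exists f.
apply: filterS (filterI th_Xi (filterI near_c (A_lim _ e2))) => n /= [nX [nc nA]].
rewrite /pdist (splitr e) EFinD; apply: leeD; last by rewrite lee_fin ltW.
have [c_in c_onto] := cP n nX.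
apply: hausdorff_le => [_ /c_onto[i <-]|f /FP[i si]].
  have [f si cf] := nc i; exists f; last exact: ltW.
  by apply/FP; exists i.
exists (c n i) => //; have [f' ] := nc i.
by rewrite si => -[<-]; rewrite norm2_distC => /ltW.
Qed.
End limit_parameter.

(** * Consistency *)

Section empirical.
Context {R : realType} {d d' : measure_display} {Omega : measurableType d}
  {T : measurableType d'} {Pr : probability Omega R} {P : probability T R}
  {X : nat -> {RV Pr >-> T}}.

Lemma integral_empirical (h : T -> R) (n : nat) (w : Omega) :
  measurable_fun setT h -> (forall x, 0 <= h x) ->
  (\int[empirical X n w]_x (h x)%:E = (n%:R^-1 * \sum_(i < n) h (X i w))%:E)%E.
Proof.
move=> mh h0; have mEh : measurable_fun setT (EFin \o h) by exact/measurable_EFinP.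
rewrite ge0_integral_mscale//; last by move=> x _; rewrite lee_fin.
rewrite ge0_integral_measure_sum//; last by move=> x _; rewrite lee_fin.
rewrite EFinM -sumEFin; congr (_ * _)%E; apply: eq_bigr => i _.
by rewrite integral_dirac// diracT mul1e.
Qed.

Lemma mutually_independent_pair (i j : nat) (A B : set T) :
  mutually_independent X -> i != j -> measurable A -> measurable B ->
  (Pr (X i @^-1` A `&` X j @^-1` B) = Pr (X i @^-1` A) * Pr (X j @^-1` B))%E.
Proof.
move=> X_indep ij mA mB.
pose C l := if l == i then A else B.
have ji : (j == i) = false by rewrite eq_sym (negbTE ij).
have mC l : measurable (C l) by rewrite /C; case: ifP.
have := X_indep [fset i; j]%fset C mC.
rewrite big_fsetU1 ?inE//= big_seq_fset1 {2 3}/C eqxx ji => <-; congr (Pr _).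
apply/seteqP; split=> w /=.
  by move=> [Aw Bw] l /=; rewrite !inE /C => /orP[/eqP ->|/eqP ->]; rewrite ?eqxx ?ji.
move=> H; split.
  by have := H i; rewrite /C/= !inE eqxx; apply.
by have := H j; rewrite /C/= !inE eqxx ji orbT; apply.
Qed.

Lemma slln_empirical (h : T -> R) :
  mutually_independent X ->
  (forall i B, measurable B -> distribution Pr (X i) B = P B) ->
  measurable_fun setT h -> (forall x, 0 <= h x) ->
  (\int[P]_x (h x)%:E < +oo)%E ->
  {ae Pr, forall w, forall e, 0 < e -> \forall n \near \oo,
    (\int[empirical X n w]_x (h x)%:E <= \int[P]_x (h x)%:E + e%:E)%E /\
    (\int[P]_x (h x)%:E <= \int[empirical X n w]_x (h x)%:E + e%:E)%E}.
Proof.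
move=> X_indep X_distr mh h0 h_fin.
have X_pair i j A B : i != j -> measurable A -> measurable B ->
    Pr (X i @^-1` A `&` X j @^-1` B) = (P A * P B)%E.
  by move=> ij mA mB; rewrite mutually_independent_pair// -(X_distr i A mA) -(X_distr j B mB).
have I0 : (0 <= \int[P]_x (h x)%:E)%E.
  by apply: integral_ge0 => x _; rewrite lee_fin.
have aE : (\int[P]_x (h x)%:E = (fine (\int[P]_x (h x)%:E))%:E)%E.
  by rewrite fineK// ge0_fin_numE.
move: (slln X_distr X_pair h _ mh h0 aE); rewrite aE /=.
set a := fine _ => H; apply: filterS H => w Hw e e0.
apply: filterS2 (Hw e e0) (nbhs_infty_gt 0) => n; rewrite integral_empirical//.
set s := \sum_(i < n) _ => Hn n0.
have n0' : 0 < n%:R :> R by rewrite ltr0n.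
have : `|n%:R^-1 * s - a| <= e.
  rewrite -(ler_pM2l n0') -{1}(ger0_norm (ltW n0')) -normrM mulrBr mulrA.
  by rewrite mulfV ?mul1r// gt_eqF.
by rewrite ler_norml !lee_fin => /andP[? ?]; split; lra.
Qed.
End empirical.

Section risk_lt_sup.
Context {R : realType} {p q k : nat} {phi : R -> R}.
Context (phi_ge0 : forall r : R, 0 <= phi r)
  (phi_nondecreasing : {homo phi : r s / r <= s})
  (phi_continuous : continuous phi) (phi0 : phi 0 = 0).
Context {P : probability (borelcV R p) R}.

Lemma ball_gt0_exists (rho : R) : 0 < rho -> exists y : 'cV[R]_p,
  (0 < P [set x : borelcV R p | (norm2 ((x : 'cV[R]_p) - y) <= rho)%R])%E.
Proof.
move=> rho0; apply: contrapT => /forallNP B0.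
pose B (y : 'cV[R]_p) := [set x : borelcV R p | norm2 ((x : 'cV[R]_p) - y) <= rho].
have mB y : measurable (B y).
  by rewrite -[B y]setTI; apply: measurable_fun_le => //; exact: measurable_norm2_dist.
have PB y : P (B y) = 0%E.
  by apply/eqP; rewrite eq_le measure_ge0 andbT leNgt; apply/negP; exact: B0.
pose F n := if (choice.unpickle n : option 'cV[rat]_p) is Some z
  then B (map_mx ratr z) else set0.
have : P.-negligible (\bigcup_n F n).
  apply: negligible_bigcup => n; rewrite /F; case: choice.unpickle => [z|].
    by exists (B (map_mx ratr z)); split; [exact: mB|exact: PB|].
  exact: negligible_set0.
have -> : \bigcup_n F n = setT.
  apply/seteqP; split=> // x _; have [z zx] := rat_vector_dense (x : 'cV[R]_p) _ rho0.
  by exists (choice.pickle z) => //; rewrite /F choice.pickleK; exact: ltW.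
move=> [N [mN N0 TN]].
have := probability_setT P; rewrite (_ : setT = N) ?N0; last exact/seteqP.
by move/eqP; rewrite eq_sym onee_eq0.
Qed.

Lemma minrisk_lt_sup (m : R) : (0 < k)%N -> (0 < q)%N -> (q <= p)%N ->
  (exists r, phi r != 0) -> minrisk q phi k P = m%:E -> exists L, m < phi L.
Proof.
move=> k0 q0 qp [r r_neq0] mE; apply: contrapT => /forallNP phi_m.
have {}phi_m L : phi L <= m by rewrite leNgt; apply/negP; exact: phi_m.
have m0 : 0 < m by rewrite (lt_le_trans _ (phi_m r))// lt_neqAle eq_sym r_neq0/=.
have m2 : 0 < m / 2 by rewrite divr_gt0.
have [rho rho0 phi_rho] : exists2 rho, 0 < rho & phi rho <= m / 2.
  have /cvgrPdist_lt/(_ _ m2) phi_near := phi_continuous 0.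
  have /nbhs_ballP[dl /= dl0 dlP] := phi_near.
  exists (dl / 2); first by rewrite divr_gt0.
  have /dlP : ball 0 dl (dl / 2) by rewrite /ball/= sub0r normrN gtr0_norm; lra.
  by rewrite /= phi0 sub0r normrN ger0_norm// => /ltW.
have [y yB] := ball_gt0_exists _ rho0.
set B := [set x | _] in yB.
have mB : measurable B.
  by rewrite -[B]setTI; apply: measurable_fun_le => //; exact: measurable_norm2_dist.
have [A [f [AA Af]]] := orthonormal_range _ _ y q0 qp.
pose th : param R p q := ([fset f]%fset, A).
have Xth : Xi k th.
  by split => //=; rewrite ?cardfs1// -cardfs_gt0 cardfs1.
pose g (x : borelcV R p) := phi (norm2 ((x : 'cV[R]_p) - y)).
have mg : measurable_fun setT g by exact: measurable_phi_dist.
have m_g : (m%:E <= \int[P]_x (g x)%:E)%E.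
  rewrite -mE (le_trans (minrisk_le _ _ _ Xth))// /Phi.
  apply: ge0_le_integral => //.
  - by move=> x _; exact: (loss_ge0 phi_ge0 th).
  - exact: (measurable_loss phi_continuous th).
  - exact/measurable_EFinP.
  - move=> x _; rewrite /g -Af; apply: (bigmine_le _ _ f); exact: fset11.
have : (\int[P]_x ((g x)%:E + (m / 2)%:E * (\1_B x)%:E) <= m%:E)%E.
  rewrite -(integral_prob_cst P); apply: ge0_le_integral => //.
  - by move=> x _; rewrite -EFinM -EFinD lee_fin addr_ge0 ?phi_ge0// mulr_ge0// ltW.
  - apply/measurable_EFinP; apply: measurable_funD => //.
    by apply: measurable_funM => //; exact: measurable_indic.
  - move=> x _; rewrite -EFinM -EFinD lee_fin indicE.
    have [xB|_] := boolP (x \in B); last by rewrite mulr0 addr0 phi_m.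
    have /phi_nondecreasing : norm2 ((x : 'cV[R]_p) - y) <= rho by move: xB; rewrite inE.
    by rewrite -/(g x) mulr1; lra.
rewrite ge0_integralD//; first last.
- by apply/measurable_EFinP; apply: measurable_funM => //; exact: measurable_indic.
- by move=> x _; rewrite -EFinM lee_fin mulr_ge0// ltW.
- exact/measurable_EFinP.
- by move=> x _; rewrite lee_fin phi_ge0.
rewrite ge0_integralZl_EFin//; last 2 first.
- by apply/measurable_EFinP; exact: measurable_indic.
- exact: ltW.
rewrite integral_indic// setIT => H.
have PB : (P B = (fine (P B))%:E)%E by rewrite fineK// fin_num_measure.
have /= := le_trans (leeD2r _ m_g) H.
rewrite PB -EFinM -EFinD lee_fin gerDl leNgt mulr_gt0//.
by move: yB; rewrite PB lte_fin.
Qed.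
End risk_lt_sup.

Lemma ae_forall_count {R : realType} {d} {T : measurableType d}
    {mu : {measure set T -> \bar R}} {I : countType} (A : I -> T -> Prop) :
  (forall i, {ae mu, forall x, A i x}) -> {ae mu, forall x, forall i, A i x}.
Proof.
move=> HA.
pose B n x := if (choice.unpickle n : option I) is Some i then A i x else True.
have HB n : {ae mu, forall x, B n x}.
  by rewrite /B; case: (choice.unpickle n) => [i|]; [exact: HA|exact: aeW].
apply: filterS (ae_foralln HB) => x Bx i.
by have := Bx (choice.pickle i); rewrite /B choice.pickleK.
Qed.

Lemma ereal_cvg_of_near {R : realType} (u : nat -> \bar R) (a : R) :
  (forall e, 0 < e -> \forall n \near \oo, ((a - e)%:E <= u n)%E) ->
  (forall e, 0 < e -> \forall n \near \oo, (u n <= (a + e)%:E)%E) ->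
  u @ \oo --> a%:E.
Proof.
move=> u_ge u_le; apply/fine_cvgP; split.
  apply: filterS2 (u_ge 1 ltr01) (u_le 1 ltr01) => n n1 n2.
  by rewrite fin_numElt (lt_le_trans _ n1) ?ltNyr// (le_lt_trans n2) ?ltry.
apply/cvgrPdist_le => e e0; apply: filterS2 (u_ge e e0) (u_le e e0) => n n1 n2.
have un : u n \is a fin_num.
  by rewrite fin_numElt (lt_le_trans _ n1) ?ltNyr// (le_lt_trans n2) ?ltry.
move: n1 n2; rewrite -(fineK un) !lee_fin /= => n1 n2.
by rewrite ler_norml; apply/andP; split; lra.
Qed.

Theorem theorem1 (R : realType) (p q k : nat)
    (hp : (0 < p)%N) (hq : (0 < q)%N) (hk : (0 < k)%N) (hqp : (q <= p)%N)
    (d : measure_display) (Omega : measurableType d) (Pr : probability Omega R)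
    (P : probability (borelcV R p) R)
    (X : nat -> {RV Pr >-> borelcV R p})
    (X_indep : mutually_independent X)
    (X_distr : forall i B, measurable B -> distribution Pr (X i) B = P B)
    (phi : R -> R)
    (phi_ge0 : forall r : R, 0 <= phi r)
    (phi_nondecreasing : {homo phi : r s / r <= s})
    (phi_continuous : continuous phi)
    (phi0 : phi 0 = 0)
    (lambda : R) (lambda_gt0 : 0 < lambda)
    (phi_doubling : forall r : R, 0 < r -> phi (2 * r) <= lambda * phi r)
    (theta_hat : nat -> Omega -> param R p q)
    (theta_hat_sel : forall n, (0 < n)%N ->
       measurable_selection k (theta_hat n)
         (fun w => minimizers q phi k (empirical X n w)))
    (phi_int : (\int[P]_x (phi (norm2 (x : 'cV[R]_p)))%:E < +oo)%E)
    (risk_gap : forall j, (1 <= j <= k.-1)%N ->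
       (minrisk q phi k P < minrisk q phi j P)%E) :
  [/\ minimizers q phi k P !=set0,
      {ae Pr, forall w,
        (fun n => pdist_set (theta_hat n w) (minimizers q phi k P)) @ \oo
          --> 0%E} &
      {ae Pr, forall w,
        (fun n => minrisk q phi k (empirical X n w)) @ \oo
          --> minrisk q phi k P}].
Proof.
have [A0 A0_orth] := @orthonormal_exists R p q hqp.
pose th0 : param R p q := ([fset 0]%fset, A0).
have th0_Xi : Xi k th0 by split; rewrite /= ?cardfs1// -cardfs_gt0 cardfs1.
have th0_fin : (Phi phi th0 P < +oo)%E.
  apply: le_lt_trans phi_int; apply: ge0_le_integral => //.
  - by move=> x _; exact: (loss_ge0 phi_ge0 th0).
  - exact: (measurable_loss phi_continuous th0).
  - apply/measurable_EFinP; have := measurable_phi_dist phi_continuous (0 : 'cV[R]_p).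
    by under eq_fun do rewrite subr0.
  - move=> x _; have := bigmine_le _
      (fun f => (phi (norm2 ((x : 'cV[R]_p) - A0 *m f)))%:E) _ (fset11 (0 : 'cV[R]_q)).
    by rewrite mulmx0 subr0.
have [phi_zero|/existsNP[r0 /eqP r0_neq0]] := pselect (forall r, phi r = 0).
  have Phi_zero (th : param R p q) Q : Xi k th -> Phi phi th Q = 0%E.
    move=> [/fset0Pn[f fth] _ _]; apply: integral0_eq => x _; apply/eqP.
    rewrite eq_le (loss_ge0 phi_ge0) andbT -[leRHS]/(0%:E).
    rewrite -(phi_zero (norm2 ((x : 'cV[R]_p) - th.2 *m f))).
    exact: (bigmine_le _ (fun f => (phi (norm2 ((x : 'cV[R]_p) - th.2 *m f)))%:E)).
  have min_zero (Q : {measure set (borelcV R p) -> \bar R}) : minrisk q phi k Q = 0%E.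
    apply/eqP; rewrite eq_le minrisk_ge0// andbT.
    by rewrite -(Phi_zero _ Q th0_Xi); exact: minrisk_le.
  have minE : minimizers q phi k P = Xi k.
    by apply/seteqP; split=> [th []//|th Xth]; split; rewrite // Phi_zero// min_zero.
  split.
  - by exists th0; rewrite minE.
  - apply: aeW => w; apply: cvg_near_cst; exists 1%N => // n n0.
    have [_ /(_ w)[Xth _]] := theta_hat_sel n n0; have [th_neq0 _ _] := Xth.
    apply/eqP; rewrite eq_le pdist_set_ge0// andbT.
    by rewrite -(pdist_xx _ _ th_neq0); apply: pdist_set_le; rewrite minE.
  - by apply: aeW => w; apply: cvg_near_cst; apply: nearW => n; rewrite !min_zero.
have [m mE] : exists m, minrisk q phi k P = m%:E.
  exists (fine (minrisk q phi k P)); rewrite fineK// ge0_fin_numE ?minrisk_ge0//.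
  exact: le_lt_trans (minrisk_le _ _ _ th0_Xi) th0_fin.
have [L mL] : exists L, m < phi L.
  apply: (@minrisk_lt_sup R p q k phi _ _ _ _ P) => //; by exists r0.
have [ths [ths_Xi ths_m]] : minimizers q phi k P !=set0.
  have /choice[th thP] (n : nat) : exists th : param R p q,
      Xi k th /\ (Phi phi th P <= (m + n.+1%:R^-1)%:E)%E.
    have : (ereal_inf [set Phi phi th P | th in @Xi R p q k] < (m + n.+1%:R^-1)%:E)%E.
      by rewrite -/(minrisk q phi k P) mE lte_fin ltrDl.
    by move=> /ereal_inf_lt[_ [th Xth <-] /ltW th_m]; exists th.
  have [U [UU FU]] := ultraFilterLemma (@eventually_filter).
  have UP := @ultra_proper _ _ UU.
  have [|||||th' [th'_Xi th'_m _]] := limit_parameter phi_ge0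
    phi_nondecreasing phi_continuous risk_gap U (fun=> P) th m UU.
  - by move=> t r e e0; apply: nearW => n; rewrite leeDl// lee_fin ltW.
  - by apply: nearW => n; have [] := thP n.
  - move=> e e0; apply: FU; apply: filterS (near_invS_lt _ e0) => n ne.
    have [_ /le_trans] := thP n; apply; rewrite lee_fin lerD2l ltW//.
  - by rewrite mE.
  - by exists L.
  by exists th'; split => //; apply/eqP; rewrite eq_le minrisk_le// mE th'_m.
rewrite mE in ths_m.
have [ths_neq0 _ _] := ths_Xi.
pose g (x : borelcV R p) := fine (\big[mine/+oo]_(f <- ths.1)
  (phi (norm2 ((x : 'cV[R]_p) - ths.2 *m f)))%:E)%E.
have gE x : (g x)%:E = (\big[mine/+oo]_(f <- ths.1)
    (phi (norm2 ((x : 'cV[R]_p) - ths.2 *m f)))%:E)%E.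
  by rewrite /g fineK//; exact: (loss_fin_num phi_ge0 ths).
have g0 x : 0 <= g x by rewrite -lee_fin gE; exact: (loss_ge0 phi_ge0 ths).
have mg : measurable_fun setT g.
  apply/measurable_EFinP; apply: eq_measurable_fun (measurable_loss phi_continuous ths).
  by move=> x _; rewrite -gE.
have PhiE Q : Phi phi ths Q = (\int[Q]_x (g x)%:E)%E.
  by apply: eq_integral => x _; rewrite gE.
have g_slln := slln_empirical g X_indep X_distr mg g0.
rewrite -PhiE ths_m in g_slln; have {}g_slln := g_slln (ltry _).
have s_slln : {ae Pr, forall w, forall tr : {ffun 'I_k -> option 'cV[rat]_p} * nat,
    forall e, 0 < e -> \forall n \near \oo,
    (\int[empirical X n w]_x (surrogate phi k tr.1 tr.2 x)%:E <=
      \int[P]_x (surrogate phi k tr.1 tr.2 x)%:E + e%:E)%E /\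
    (\int[P]_x (surrogate phi k tr.1 tr.2 x)%:E <=
      \int[empirical X n w]_x (surrogate phi k tr.1 tr.2 x)%:E + e%:E)%E}.
  apply: ae_forall_count => -[t r] /=.
  have ms := @measurable_surrogate R p phi phi_continuous k t r.
  have s0 x := surrogate_bounds phi_ge0 k t r x.
  apply: slln_empirical => //; first by move=> x; have /andP[] := s0 x.
  apply: (@le_lt_trans _ _ r%:R%:E); last exact: ltry.
  rewrite -(integral_prob_cst P); apply: ge0_le_integral => //.
  - by move=> x _; rewrite lee_fin; have /andP[] := s0 x.
  - exact/measurable_EFinP.
  - by move=> x _; rewrite lee_fin; have /andP[] := s0 x.
have limit w (s_w : forall tr : {ffun 'I_k -> option 'cV[rat]_p} * nat,
    forall e, 0 < e -> \forall n \near \oo,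
    (\int[empirical X n w]_x (surrogate phi k tr.1 tr.2 x)%:E <=
      \int[P]_x (surrogate phi k tr.1 tr.2 x)%:E + e%:E)%E /\
    (\int[P]_x (surrogate phi k tr.1 tr.2 x)%:E <=
      \int[empirical X n w]_x (surrogate phi k tr.1 tr.2 x)%:E + e%:E)%E)
    (U : set_system nat) (b : R) : UltraFilter U -> \oo `<=` U -> b <= m ->
    (forall e, 0 < e ->
      U [set n | (minrisk q phi k (empirical X n w) <= (b + e)%:E)%E]) ->
    exists th' : param R p q, [/\ Xi k th', (Phi phi th' P <= b%:E)%E &
      forall e, 0 < e -> U [set n | (pdist (theta_hat n w) th' <= e%:E)%E]].
  move=> UU FU bm Ub; have UP := @ultra_proper _ _ UU.
  apply: (limit_parameter phi_ge0 phi_nondecreasing phi_continuous risk_gap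
    U (fun n => empirical X n w)) => //.
  - move=> t r e e0; apply: FU; apply: filterS (s_w (t, r) e e0) => n [_].
    exact.
  - apply: FU; apply: filterS (nbhs_infty_gt 0) => n n0.
    by have [_ /(_ w)[]] := theta_hat_sel n n0.
  - move=> e e0; have Un : U [set n | (0 < n)%N] by apply: FU; exact: nbhs_infty_gt.
    apply: filterS (filterI Un (Ub e e0)) => n /= [n0 nb].
    by have [_ /(_ w)[_ ->]] := theta_hat_sel n n0.
  - by rewrite mE lee_fin.
  - by exists L; rewrite (le_lt_trans bm).
have risk_le w : (forall e, 0 < e -> \forall n \near \oo,
      (\int[empirical X n w]_x (g x)%:E <= m%:E + e%:E)%E /\
      (m%:E <= \int[empirical X n w]_x (g x)%:E + e%:E)%E) ->
    forall e, 0 < e -> \forall n \near \oo,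
      (minrisk q phi k (empirical X n w) <= (m + e)%:E)%E.
  move=> gw e e0; apply: filterS (gw e e0) => n [n_le _].
  by rewrite (le_trans (minrisk_le _ _ _ ths_Xi))// PhiE.
split; first by exists ths; split; rewrite // ths_m mE.
- apply: filterS2 g_slln s_slln => w g_w s_w.
  apply: ereal_cvg_of_near => e e0; rewrite ?sub0r ?add0r.
    apply: filterS (nbhs_infty_gt 0) => n n0.
    have [_ /(_ w)[[th_neq0 _ _] _]] := theta_hat_sel n n0.
    by rewrite (le_trans _ (pdist_set_ge0 _ _ _ th_neq0))// lee_fin oppr_le0 ltW.
  apply: near_ultra => U UU FU; have UP := @ultra_proper _ _ UU.
  have [|th' [th'_Xi th'_m th'_lim]] := limit w s_w U m UU FU (lexx m).
    by move=> e' e'0; apply: FU; exact: risk_le.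
  apply: filterS (th'_lim e e0) => n; apply: le_trans; apply: pdist_set_le.
  by split => //; apply/eqP; rewrite eq_le minrisk_le// mE th'_m.
- apply: filterS2 g_slln s_slln => w g_w s_w.
  rewrite mE; apply: ereal_cvg_of_near => e e0; last exact: risk_le.
  apply: near_ultra => U UU FU; have UP := @ultra_proper _ _ UU.
  have [//|UnA] := in_ultra_setVsetC
    [set n | ((m - e)%:E <= minrisk q phi k (empirical X n w))%E] UU.
  have [||th' [th'_Xi th'_m _]] := limit w s_w U (m - e) UU FU.
  - by rewrite gerBl ltW.
  - move=> e' e'0; apply: filterS UnA => n /= /negP; rewrite -ltNge => /ltW n_le.
    by rewrite (le_trans n_le)// lee_fin lerDl ltW.
  have := le_trans (minrisk_le _ _ _ th'_Xi) th'_m.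
  by rewrite mE lee_fin; lra.
Qed.
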